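(* Let $\mathbf{B}$ be a full subcategory of the category $\mathbf{A}$ of topological algebras such that for every $A$ in $\mathbf{B}$ the algebra $A^{\infty(I)}$ also lies in $\mathbf{B}$. Then: (1) the natural homomorphism $K_1(A)\to K_1^{sm}(A)$ is an isomorphism for all $A$ in $\mathbf{B}$ (i.e. $K_1$ and $K_1^{sm}$ are isomorphic functors on $\mathbf{B}$) if and only if $K_1$ is a smooth homotopy functor on $\mathbf{B}$; (2) the natural homomorphism $kv_1(A)\to K_1^{sm}(A)$ is an isomorphism for all $A$ in $\mathbf{B}$ (i.e. $kv_1$ and $K_1^{sm}$ are isomorphic functors on $\mathbf{B}$) if and only if $kv_1$ is a smooth homotopy functor on $\mathbf{B}$.
   Context: Topological algebras are complex algebras with a topology making the operations continuous; morphisms are continuous algebra homomorphisms. For a topological algebra $A$, $A^{\infty(I)}$ is the topological algebra of smooth maps $I=[0,1]\to A$; $\varepsilon_0,\varepsilon_1:A^{\infty(I)}\to A$ are evaluation at $0$ and $1$. Let $\mathfrak{I}(A)=\ker\varepsilon_0$ and $\tau_A:\mathfrak{I}(A)\to A$ the restriction of $\varepsilon_1$; there is a homomorphism $\delta_A:\mathfrak{I}(A)\to\mathfrak{I}^2(A)$, $\delta_A(f)(s,t)=f(st)$. This gives a cotriple (comonad) $\mathfrak{I}$ (counit $\tau$, comultiplication $\delta$), and hence an augmented simplicial group $GL(\mathfrak{I}_*(A))\to GL(A)$ with $GL(\mathfrak{I}_k(A))=GL(\mathfrak{I}^{k+1}(A))$. The smooth $K$-groups are $K_n^{sm}(A)=\pi_{n-2}GL(\mathfrak{I}_*(A))$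 for $n\ge3$, and for $n=1,2$ they are defined by the exact sequence $0\to K_2^{sm}(A)\to\pi_0 GL(\mathfrak{I}_*(A))\to GL(A)\to K_1^{sm}(A)\to 0$ (so $K_1^{sm}(A)$ is the cokernel of $GL(\mathfrak{I}(A))\to GL(A)$ induced by $\tau_A$). $K_n$ denotes Quillen algebraic $K$-theory and $kv_n$ Karoubi–Villamayor $K$-theory (defined via the polynomial cotriple). The natural maps $K_n(A)\to kv_n(A)\to K_n^{sm}(A)$ are induced by the natural transformations from the free cotriple to the polynomial cotriple ($|a|\mapsto ax$) and from the polynomial cotriple to $\mathfrak{I}$ (sending $ax$ to the path $t\mapsto at$). Two continuous homomorphisms $f,g:A\to B$ are smoothly homotopic if there is a continuous homomorphism $h:A\to B^{\infty(I)}$ with $\varepsilon_0h=f$ and $\varepsilon_1h=g$. A functor $T$ from a category of topological algebras to groups is a smooth homotopy functor if $T(f)=T(g)$ whenever $f,g$ are smoothly homotopic. *)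

(* Defs.v *)
From HB Require Import structures.
From mathcomp Require Import all_boot all_order all_algebra.
From mathcomp Require Import all_classical all_reals all_analysis.
From mathcomp.real_closed Require Import complex.
Import Order.TTheory GRing.Theory Num.Theory.
Import numFieldNormedType.Exports.

Set Implicit Arguments.
Unset Strict Implicit.
Unset Printing Implicit Defensive.

Local Open Scope classical_set_scope.
Local Open Scope ring_scope.

(* Topological (not necessarily unital) complex algebras, as raw data.       *)
(* An algebra is given by an ambient topological type [tcar], the subset     *)
(* [tdom] of it consisting of the elements of the algebra (with the subspace *)
(* topology), and the operations.  [is_talg] says that this data is a        *)
(* topological complex algebra.                                              *)

Section Defs.
Variable R : realType.
Local Notation CC := (R[i])%type.

Record talg := TAlg {
  tcar : topologicalType;
  tdom : set tcar;
  tzero : tcar;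
  tadd : tcar -> tcar -> tcar;
  topp : tcar -> tcar;
  tmul : tcar -> tcar -> tcar;
  tscale : CC -> tcar -> tcar }.

Arguments tdom : clear implicits.
Arguments tzero : clear implicits.
Arguments tadd : clear implicits.
Arguments topp : clear implicits.
Arguments tmul : clear implicits.
Arguments tscale : clear implicits.

Definition is_talg (A : talg) : Prop :=
  let D := tdom A in
  let add := tadd A in let mul := tmul A in let sc := tscale A in
  (D (tzero A) /\ (forall x y, D x -> D y -> D (add x y) /\ D (mul x y))
   /\ (forall x, D x -> D (topp A x)) /\ (forall c x, D x -> D (sc c x))) /\
  (forall x y z, D x -> D y -> D z ->
     add x (add y z) = add (add x y) z /\ add x y = add y x /\
     add (tzero A) x = x /\ add (topp A x) x = tzero A) /\
  (forall (a b : CC) x y, D x -> D y ->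
     sc 1 x = x /\ sc (a * b) x = sc a (sc b x) /\
     sc a (add x y) = add (sc a x) (sc a y) /\ sc (a + b) x = add (sc a x) (sc b x)) /\
  (forall (a : CC) x y z, D x -> D y -> D z ->
     mul x (mul y z) = mul (mul x y) z /\
     mul x (add y z) = add (mul x y) (mul x z) /\
     mul (add x y) z = add (mul x z) (mul y z) /\
     mul (sc a x) y = sc a (mul x y) /\ mul x (sc a y) = sc a (mul x y)) /\
  {within [set p : tcar A * tcar A | D p.1 /\ D p.2],
     continuous (fun p : tcar A * tcar A => add p.1 p.2)} /\
  {within [set p : tcar A * tcar A | D p.1 /\ D p.2],
     continuous (fun p : tcar A * tcar A => mul p.1 p.2)} /\
  {within D, continuous (topp A)} /\
  {within [set p : (CC^o) * tcar A | D p.2],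
     continuous (fun p : (CC^o) * tcar A => sc p.1 p.2)}.

Definition is_hom (A B : talg) (f : tcar A -> tcar B) : Prop :=
  (forall x, tdom A x -> tdom B (f x)) /\
  (forall x y, tdom A x -> tdom A y ->
     f (tadd A x y) = tadd B (f x) (f y) /\ f (tmul A x y) = tmul B (f x) (f y)) /\
  (forall (c : CC) x, tdom A x -> f (tscale A c x) = tscale B c (f x)) /\
  {within tdom A, continuous f}.

Definition tsum (A : talg) (s : seq (tcar A)) : tcar A :=
  foldr (tadd A) (tzero A) s.

(* The algebra A^{oo(I)} of smooth maps I = [0,1] -> A.  A smooth map f is   *)
(* recorded together with its derivatives: an element is a sequence          *)
(* F : nat -> R -> A with F 0 = f, F (k+1) the derivative of F k on [0,1]    *)
(* (one-sided at the end points), each F k continuous, and each F k          *)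
(* extended to R by F k t = F k (clamp t) (so that it is determined by its   *)
(* values on I).  The topology is that of uniform convergence on I of all    *)
(* derivatives (compact-open topology on each F k).                          *)

Definition clamp01 (t : R) : R := Order.max 0 (Order.min 1 t).

Definition is_deriv_on01 (A : talg) (f g : R -> tcar A) : Prop :=
  forall t : R, 0 <= t <= 1 ->
    (fun h : R => tscale A ((h^-1)%:C)%C (tadd A (f (t + h)) (topp A (f t))))
      @ (within [set h : R | 0 <= t + h <= 1] (0 : R)^') --> g t.

Definition is_smooth_jet (A : talg) (F : nat -> R -> tcar A) : Prop :=
  forall k : nat,
    (forall t, F k t = F k (clamp01 t)) /\
    (forall t, tdom A (F k t)) /\
    continuous (F k) /\
    is_deriv_on01 (F k) (F k.+1).

Definition jet_top (A : talg) : topologicalType :=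
  @initial_topology (nat -> R -> tcar A)
    (prod_topology (fun _ : nat => {compact-open, R -> tcar A}))
    (fun F => F).

Definition jet_mul (A : talg) (F G : nat -> R -> tcar A) : nat -> R -> tcar A :=
  fun k t => tsum [seq tscale A ('C(k, j))%:R (tmul A (F j t) (G (k - j)%N t))
                  | j <- iota 0 k.+1].

Definition jet_alg (A : talg) (P : set (nat -> R -> tcar A)) : talg :=
  @TAlg (jet_top A) P
    (fun _ _ => tzero A)
    (fun F G k t => tadd A (F k t) (G k t))
    (fun F k t => topp A (F k t))
    (@jet_mul A)
    (fun c F k t => tscale A c (F k t)).

Definition Ainf (A : talg) : talg := jet_alg (@is_smooth_jet A).

Definition ev0 (A : talg) (F : tcar (Ainf A)) : tcar A := F 0%N 0.
Definition ev1 (A : talg) (F : tcar (Ainf A)) : tcar A := F 0%N 1.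

Definition Ipath (A : talg) : talg :=
  jet_alg [set F | @is_smooth_jet A F /\ F 0%N 0 = tzero A].

Definition smoothly_homotopic (A B : talg) (f g : tcar A -> tcar B) : Prop :=
  exists h : tcar A -> tcar (Ainf B),
    @is_hom A (Ainf B) h /\
    forall a, tdom A a -> ev0 (h a) = f a /\ ev1 (h a) = g a.

(* The polynomial cotriple: P(A) = x A[x] (polynomials without constant     *)
(* term), coefficients indexed by nat; evaluation at 1.  Only its algebraic *)
(* structure is used (the topology field is irrelevant).                    *)

Definition poly_fin (A : talg) (d : nat) (p : nat -> tcar A) : Prop :=
  forall k, (d < k)%N -> p k = tzero A.

Definition PX (A : talg) : talg :=
  @TAlg (prod_topology (fun _ : nat => tcar A))
    [set p | p 0%N = tzero A /\ (forall k, tdom A (p k)) /\ exists d, poly_fin d p]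
    (fun _ => tzero A)
    (fun p q k => tadd A (p k) (q k))
    (fun p k => topp A (p k))
    (fun p q m => tsum [seq tmul A (p a) (q (m - a)%N) | a <- iota 0 m.+1])
    (fun c p k => tscale A c (p k)).

Definition pbnd (A : talg) (p : tcar (PX A)) : nat :=
  xget 0%N [set d | poly_fin d p].

Definition evp1 (A : talg) (p : tcar (PX A)) : tcar A :=
  tsum [seq p k | k <- iota 0 (pbnd p).+1].

(* GL(A) for a (non-unital) algebra A.  GL(A) is the kernel of               *)
(* GL(A^+) -> GL(C); an element 1 + M of it is represented by the finitely   *)
(* supported infinite matrix M over A, and the product (1+M)(1+N) = 1 + M o N *)
(* with M o N = M + N + M N.                                                 *)

Definition mat (A : talg) := nat -> nat -> tcar A.

Definition mzero (A : talg) : mat A := fun _ _ => tzero A.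

Definition msupp (A : talg) (n : nat) (M : mat A) : Prop :=
  forall i j, (n <= i)%N || (n <= j)%N -> M i j = tzero A.

Definition mvalid (A : talg) (M : mat A) : Prop :=
  (exists n, msupp n M) /\ forall i j, tdom A (M i j).

Definition mbnd (A : talg) (M : mat A) : nat := xget 0%N [set n | msupp n M].

Definition madd (A : talg) (M N : mat A) : mat A := fun i j => tadd A (M i j) (N i j).

Definition mmul (A : talg) (M N : mat A) : mat A :=
  fun i j => tsum [seq tmul A (M i k) (N k j) | k <- iota 0 (mbnd M)].

Definition circ (A : talg) (M N : mat A) : mat A := madd (madd M N) (mmul M N).

Definition qinv (A : talg) (M N : mat A) : Prop :=
  mvalid N /\ circ M N = mzero A /\ circ N M = mzero A.

Definition GL (A : talg) (M : mat A) : Prop := mvalid M /\ exists N, qinv M N.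

Definition mmap (A B : talg) (f : tcar A -> tcar B) (M : mat A) : mat B :=
  fun i j => f (M i j).

(* The relative elementary group E(A) = E(A^+, A): the normal closure in     *)
(* E(A^+) of the elementary matrices e_ij(a), a in A.                        *)

(* e_ij(a) = 1 + a E_ij *)
Definition elm (A : talg) (i j : nat) (a : tcar A) : mat A :=
  fun p q => if (p == i) && (q == j) then a else tzero A.

(* left / right multiplication by x = (lam, c) in A^+ = C x A *)
Definition lmulp (A : talg) (lam : CC) (c a : tcar A) : tcar A :=
  tadd A (tscale A lam a) (tmul A c a).
Definition rmulp (A : talg) (lam : CC) (c a : tcar A) : tcar A :=
  tadd A (tscale A lam a) (tmul A a c).

(* (1 + x E_ij) (1 + M) (1 - x E_ij) = 1 + conj_e i j x M, for i <> j,
   x = (lam, c) in A^+ *)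
Definition conj_e (A : talg) (i j : nat) (lam : CC) (c : tcar A) (M : mat A) : mat A :=
  fun p q =>
    let X1 := if p == i then lmulp lam c (M j q) else tzero A in
    let X2 := if q == j then rmulp lam c (M p i) else tzero A in
    let X3 := if (p == i) && (q == j) then rmulp lam c (lmulp lam c (M j i))
              else tzero A in
    tadd A (tadd A (M p q) X1) (topp A (tadd A X2 X3)).

Definition Erel (A : talg) : set (mat A) :=
  fun M => forall S : set (mat A),
    (forall i j a, i != j -> tdom A a -> S (elm i j a)) ->
    (forall M1 M2, S M1 -> S M2 -> S (circ M1 M2)) ->
    (forall M1 M2, S M1 -> qinv M1 M2 -> S M2) ->
    (forall i j lam c M1, i != j -> tdom A c -> S M1 -> S (conj_e i j lam c M1)) ->
    S M.

Definition Nkv (A : talg) : set (mat A) :=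
  [set M | exists P : mat (PX A), GL P /\ M = mmap (@evp1 A) P].

Definition Nsm (A : talg) : set (mat A) :=
  [set M | exists F : mat (Ipath A), GL F /\
            M = mmap (fun F0 : tcar (Ipath A) => F0 0%N 1) F].

Definition nrm (A : talg) (M : mat A) : mat A := if `[< GL M >] then M else mzero A.

Definition ncls (A : talg) (N : set (mat A)) (M : mat A) : set (mat A) :=
  [set M' | GL M' /\ exists M0, qinv (nrm M) M0 /\ N (circ M0 M')].

Definition quot (A : talg) (N : set (mat A)) : Type :=
  {X : set (mat A) | exists M, X = ncls N M}.

Definition qcls (A : talg) (N : set (mat A)) (M : mat A) : quot N :=
  exist _ (ncls N M) (ex_intro _ M erefl).

Definition rep (A : talg) (N : set (mat A)) (X : quot N) : mat A :=
  nrm (proj1_sig (cid (proj2_sig X))).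

Definition K1 (A : talg) := quot (@Erel A).
Definition kv1 (A : talg) := quot (@Nkv A).
Definition K1sm (A : talg) := quot (@Nsm A).

Definition natmap (A : talg) (N1 N2 : set (mat A)) (X : quot N1) : quot N2 :=
  qcls N2 (rep X).

Definition K1_to_K1sm (A : talg) : K1 A -> K1sm A := @natmap A (@Erel A) (@Nsm A).
Definition kv1_to_K1sm (A : talg) : kv1 A -> K1sm A := @natmap A (@Nkv A) (@Nsm A).

Definition qmap (N : forall A : talg, set (mat A)) (A B : talg)
    (f : tcar A -> tcar B) (X : quot (N A)) : quot (N B) :=
  qcls (N B) (mmap f (rep X)).

Definition smooth_homotopy_functor (Bc : talg -> Prop)
    (N : forall A : talg, set (mat A)) : Prop :=
  forall (A B : talg) (f g : tcar A -> tcar B),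
    Bc A -> Bc B -> @is_hom A B f -> @is_hom A B g ->
    smoothly_homotopic f g -> @qmap N A B f = @qmap N A B g.

End Defs.

(* Main.v *)
(** If [F] is an invertible matrix over the path algebra [Ipath A], then its
    end points [F(0) = 1] and [F(1)] are the images of one matrix over [Ainf A]
    under the evaluations [ev0] and [ev1], and the identity of [Ainf A] is itself
    a smooth homotopy from [ev0] to [ev1].  So a smooth homotopy functor
    [GL / N] kills [F(1)]; that is, [Nsm] is contained in [N], and hence equal
    to it.  Conversely, if [N = Nsm] and [h] is a smooth homotopy from [f] to
    [g], then [f(M)^-1 h(M)] is a smooth path from [1] to [f(M)^-1 g(M)].
    Group computations in [GL(A)] take place in truncated matrices over the
    unitalization of [A]; polynomial paths are handled as polynomials over it. *)

From HB Require Import structures.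
From Pilot Require Import Defs.
From mathcomp Require Import all_boot all_order all_algebra.
From mathcomp Require Import all_classical all_reals all_analysis.
From mathcomp.real_closed Require Import complex.
Import Order.TTheory GRing.Theory Num.Theory.
Import numFieldNormedType.Exports.
(* Makes [mzero] denote the zero matrix again, not the zero measure. *)
Import Pilot.Defs.

Set Implicit Arguments.
Unset Strict Implicit.
Unset Printing Implicit Defensive.

Local Open Scope classical_set_scope.
Local Open Scope ring_scope.

(** Both natural maps send a coset to a coset containing it, hence are onto, and they are bijective
    exactly when the two subgroups agree. One inclusion always holds: [t |-> e_ij(ta)] joins 1 to
    [e_ij(a)], conjugating a path by a constant path covers the normal closure, and a polynomial
    without constant term is a smooth path starting at 0. The homotopy property can therefore only
    concern the reverse inclusion.

    Two features of the encoding shape the proof. Algebra laws hold only on [tdom], so sums and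
    products are moved to genuine rings, where they can be reordered. And maps out of a quotient are
    computed on a chosen representative: the class of a path [F] starting at 1 is represented by
    some [F'] that need not start at 1, and the difference is absorbed by applying both evaluations
    to [F^-1 F'], which lies in [N]. That [Ainf A] is itself an algebra comes from the closure of
    [Bc] under [Ainf], all members of [Bc] being topological algebras. *)

(* Kept separate from [is_talg] because [PX A] is used without a topology. *)
Definition is_alg (R : realType) (A : talg R) : Prop :=
  let D := @tdom R A in
  let add := @tadd R A in let mul := @tmul R A in let sc := @tscale R A in
  (D (tzero A) /\ (forall x y, D x -> D y -> D (add x y) /\ D (mul x y))
   /\ (forall x, D x -> D (topp x)) /\ (forall c x, D x -> D (sc c x))) /\
  (forall x y z, D x -> D y -> D z ->
     add x (add y z) = add (add x y) z /\ add x y = add y x /\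
     add (tzero A) x = x /\ add (topp x) x = tzero A) /\
  (forall (a b : R[i]) x y, D x -> D y ->
     sc 1 x = x /\ sc (a * b) x = sc a (sc b x) /\
     sc a (add x y) = add (sc a x) (sc a y) /\ sc (a + b) x = add (sc a x) (sc b x)) /\
  (forall (a : R[i]) x y z, D x -> D y -> D z ->
     mul x (mul y z) = mul (mul x y) z /\
     mul x (add y z) = add (mul x y) (mul x z) /\
     mul (add x y) z = add (mul x z) (mul y z) /\
     mul (sc a x) y = sc a (mul x y) /\ mul x (sc a y) = sc a (mul x y)).

Lemma talg_alg (R : realType) (A : talg R) : is_talg A -> is_alg A.
Proof. by case=> ? [? [? [? _]]]; split. Qed.

(** * The algebra laws, restricted to the domain *)

Section AlgLemmas.
Variables (R : realType) (A : talg R) (hA : is_alg A).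
Local Notation D := (@tdom R A).
Local Notation "x +t y" := (tadd x y) (at level 50).
Local Notation "x *t y" := (tmul x y) (at level 40).

Lemma dom0 : D (tzero A). Proof. by case: hA => -[]. Qed.
Lemma domD x y : D x -> D y -> D (x +t y).
Proof. by case: hA => -[_ [h _] _] dx dy; case: (h _ _ dx dy). Qed.
Lemma domM x y : D x -> D y -> D (x *t y).
Proof. by case: hA => -[_ [h _] _] dx dy; case: (h _ _ dx dy). Qed.
Lemma domN x : D x -> D (topp x).
Proof. by case: hA => -[_ [_ [h _]] _]; apply: h. Qed.
Lemma domZ c x : D x -> D (tscale c x).
Proof. by case: hA => -[_ [_ [_ h]] _]; apply: h. Qed.
Lemma taddA x y z : D x -> D y -> D z -> x +t (y +t z) = x +t y +t z.
Proof. by case: hA => _ [h _] dx dy dz; case: (h _ _ _ dx dy dz). Qed.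
Lemma taddC x y : D x -> D y -> x +t y = y +t x.
Proof. by case: hA => _ [h _] dx dy; case: (h _ _ _ dx dy dy) => _ []. Qed.
Lemma tadd0 x : D x -> tzero A +t x = x.
Proof. by case: hA => _ [h _] dx; case: (h _ _ _ dx dx dx) => _ [_ []]. Qed.
Lemma taddN x : D x -> topp x +t x = tzero A.
Proof. by case: hA => _ [h _] dx; case: (h _ _ _ dx dx dx) => _ [_ []]. Qed.
Lemma tscale1 x : D x -> tscale 1 x = x.
Proof. by case: hA => _ [_ [h _]] dx; case: (h 0 0 _ _ dx dx). Qed.
Lemma tscaleA a b x : D x -> tscale (a * b) x = tscale a (tscale b x).
Proof. by case: hA => _ [_ [h _]] dx; case: (h a b _ _ dx dx) => _ []. Qed.
Lemma tscaleDr a x y : D x -> D y -> tscale a (x +t y) = tscale a x +t tscale a y.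
Proof. by case: hA => _ [_ [h _]] dx dy; case: (h a a _ _ dx dy) => _ [_ []]. Qed.
Lemma tscaleDl a b x : D x -> tscale (a + b) x = tscale a x +t tscale b x.
Proof. by case: hA => _ [_ [h _]] dx; case: (h a b _ _ dx dx) => _ [_ []]. Qed.
Lemma tmulA x y z : D x -> D y -> D z -> x *t (y *t z) = x *t y *t z.
Proof. by case: hA => _ [_ [_ h]] dx dy dz; case: (h 0 _ _ _ dx dy dz). Qed.
Lemma tmulDr x y z : D x -> D y -> D z -> x *t (y +t z) = (x *t y) +t (x *t z).
Proof. by case: hA => _ [_ [_ h]] dx dy dz; case: (h 0 _ _ _ dx dy dz) => _ []. Qed.
Lemma tmulDl x y z : D x -> D y -> D z -> (x +t y) *t z = (x *t z) +t (y *t z).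
Proof. by case: hA => _ [_ [_ h]] dx dy dz; case: (h 0 _ _ _ dx dy dz) => _ [_ []]. Qed.
Lemma tscaleAl a x y : D x -> D y -> tscale a x *t y = tscale a (x *t y).
Proof. by case: hA => _ [_ [_ h]] dx dy; case: (h a _ _ _ dx dy dx) => _ [_ [_ []]]. Qed.
Lemma tscaleAr a x y : D x -> D y -> x *t tscale a y = tscale a (x *t y).
Proof. by case: hA => _ [_ [_ h]] dx dy; case: (h a _ _ _ dx dy dx) => _ [_ [_ []]]. Qed.
End AlgLemmas.

(* The unitalization A^+ = C x A, with first component the augmentation. *)
Definition aplus (R : realType) (A : talg R) (hA : is_alg A) : Type :=
  (R[i] * {x : tcar A | `[<tdom x>]})%type.

(** * Ring structure on the unitalization *)

Section Unitalization.
Variables (R : realType) (A : talg R) (hA : is_alg A).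
Local Notation D := (@tdom R A).
Local Notation T := (aplus hA).
Local Notation S := {x : tcar A | `[<tdom x>]}.

HB.instance Definition _ := Choice.on T.

Definition aug (x : T) : R[i] := x.1.
Definition rho (x : T) : tcar A := sval x.2.
(** Elements outside the domain are sent to zero. This makes [aplus_mk] and [emb] total, at the
    price of a [tdom] hypothesis in most laws about them. *)
Definition dom_insub (x : tcar A) : S := insubd (exist _ (tzero A) (asboolT (dom0 hA))) x.
Definition aplus_mk (c : R[i]) (x : tcar A) : T := (c, dom_insub x).
Definition emb (x : tcar A) : T := aplus_mk 0 x.

Lemma rho_dom x : D (rho x). Proof. by apply/asboolP; case: x => c [x]. Qed.
Lemma rho_mk c x : D x -> rho (aplus_mk c x) = x.
Proof. by move=> dx; rewrite /rho /aplus_mk /= insubdK //; apply/asboolP. Qed.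
Lemma aplusP (x y : T) : aug x = aug y -> rho x = rho y -> x = y.
Proof. by case: x => c x; case: y => d y; rewrite /aug /rho /= => -> /val_inj ->. Qed.

Definition aadd (x y : T) : T := aplus_mk (aug x + aug y) (tadd (rho x) (rho y)).
Definition aopp (x : T) : T := aplus_mk (- aug x) (topp (rho x)).
Definition amul (x y : T) : T := aplus_mk (aug x * aug y)
  (tadd (tadd (tscale (aug x) (rho y)) (tscale (aug y) (rho x))) (tmul (rho x) (rho y))).

Local Ltac dom := repeat first [apply: (domD hA) | apply: (domM hA)
  | apply: (domN hA) | apply: (domZ hA) | exact: (dom0 hA) | exact: rho_dom].

Lemma rho_add x y : rho (aadd x y) = tadd (rho x) (rho y).
Proof. by rewrite rho_mk //; dom. Qed.
Lemma rho_amul x y : rho (amul x y) =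
  tadd (tadd (tscale (aug x) (rho y)) (tscale (aug y) (rho x))) (tmul (rho x) (rho y)).
Proof. by rewrite rho_mk //; dom. Qed.

Lemma aaddA : associative aadd.
Proof.
move=> x y z; apply: aplusP; first by rewrite /= addrA.
by rewrite !rho_add (taddA hA) //; dom.
Qed.
Lemma aaddC : commutative aadd.
Proof.
move=> x y; apply: aplusP; first by rewrite /= addrC.
by rewrite !rho_add (taddC hA) //; dom.
Qed.
Lemma aadd0 : left_id (aplus_mk 0 (tzero A)) aadd.
Proof.
move=> x; apply: aplusP; first by rewrite /= add0r.
by rewrite !rho_add rho_mk ?(tadd0 hA) //; dom.
Qed.
Lemma aaddN : left_inverse (aplus_mk 0 (tzero A)) aopp aadd.
Proof.
move=> x; apply: aplusP; first by rewrite /= addNr.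
by rewrite !rho_add !rho_mk ?(taddN hA) //; dom.
Qed.
HB.instance Definition _ := GRing.isZmodule.Build T aaddA aaddC aadd0 aaddN.

Lemma rhoD (x y : T) : rho (x + y) = tadd (rho x) (rho y). Proof. exact: rho_add. Qed.
Lemma rho0 : rho (0 : T) = tzero A. Proof. by rewrite rho_mk //; dom. Qed.
Lemma rhoN (x : T) : rho (- x) = topp (rho x). Proof. by rewrite rho_mk //; dom. Qed.
Lemma augD (x y : T) : aug (x + y) = aug x + aug y. Proof. by []. Qed.

Lemma embD x y : D x -> D y -> emb (tadd x y) = emb x + emb y.
Proof.
move=> dx dy; apply: aplusP; first by rewrite augD /= addr0.
by rewrite rhoD !rho_mk //; apply: domD.
Qed.
Lemma emb0 : emb (tzero A) = 0. Proof. by []. Qed.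

(** From [0x = 0x + 0x]; the cancellation is carried out in the additive group of the unitalization
    and read back through [rho]. *)
Lemma tscale0 x : D x -> tscale 0 x = tzero A.
Proof.
move=> dx; have d0 := domZ hA 0 dx.
have /(congr1 emb) := tscaleDl hA 0 0 dx.
rewrite addr0 embD // => /(congr1 (fun z => z - emb (tscale 0 x))).
by rewrite addrK subrr => /(congr1 rho); rewrite rho0 rho_mk // => <-.
Qed.
Lemma tscaler0 a : tscale a (tzero A) = tzero A.
Proof.
by rewrite -(tscale0 (dom0 hA)) -(tscaleA hA) ?mulr0//; apply: dom0.
Qed.
Lemma tmul0 x : D x -> tmul (tzero A) x = tzero A.
Proof.
move=> dx; rewrite -{1}(tscale0 (dom0 hA)) (tscaleAl hA) ?tscale0 //; dom => //.
Qed.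
Lemma tmulr0 x : D x -> tmul x (tzero A) = tzero A.
Proof.
move=> dx; rewrite -{1}(tscale0 (dom0 hA)) (tscaleAr hA) ?tscale0 //; dom => //.
Qed.
Lemma taddr0 x : D x -> tadd x (tzero A) = x.
Proof. by move=> dx; rewrite (taddC hA) ?(tadd0 hA)//; dom. Qed.

(** Writing each term as [rho (emb _)] turns a reordering of [tadd] into one in a commutative group;
    [amulA] uses the same device. *)
Lemma tadd4 x y z t : D x -> D y -> D z -> D t ->
  tadd (tadd x y) (tadd z t) = tadd (tadd x z) (tadd y t).
Proof.
move=> dx dy dz dt; have e a : D a -> rho (emb a) = a by move=> ?; rewrite rho_mk.
by rewrite -(e x) // -(e y) // -(e z) // -(e t) // -!rhoD addrACA.
Qed.

Lemma amulDl : left_distributive amul +%R.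
Proof.
move=> x y z; apply: aplusP; first by rewrite augD /= mulrDl.
rewrite rhoD !rho_amul !augD !rhoD (tscaleDl hA) ?(tscaleDr hA) ?(tmulDl hA) //; try by dom.
rewrite [in RHS]tadd4; try by dom.
by congr tadd; rewrite tadd4 //; dom.
Qed.
Lemma amulDr : right_distributive amul +%R.
Proof.
move=> x y z; apply: aplusP; first by rewrite augD /= mulrDr.
rewrite rhoD !rho_amul !augD !rhoD (tscaleDl hA) ?(tscaleDr hA) ?(tmulDr hA) //; try by dom.
rewrite [in RHS]tadd4; try by dom.
by congr tadd; rewrite tadd4 //; dom.
Qed.

Lemma rho_emb x : D x -> rho (emb x) = x. Proof. exact: rho_mk. Qed.
Lemma rhoE x : D x -> x = rho (emb x). Proof. by move=> /rho_emb. Qed.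

Lemma amulA : associative amul.
Proof.
move=> x y z; apply: aplusP; first by rewrite /= mulrA.
rewrite !rho_amul /=.
have [dx dy dz] : [/\ D (rho x), D (rho y) & D (rho z)] by split; dom.
move: dx dy dz; move: (aug x) (aug y) (aug z) => a b c.
move: (rho x) (rho y) (rho z) => {}x {}y {}z dx dy dz.
have D1 : D (tmul x y) by apply: domM.
have D2 : D (tmul y z) by apply: domM.
have D3 : D (tmul x z) by apply: domM.
have D4 : D (tmul (tmul x y) z) by apply: domM.
rewrite !(tscaleDr hA, tmulDl hA, tmulDr hA, tscaleAl hA, tscaleAr hA, tmulA hA) //;
  try by repeat first [assumption | apply: (domD hA) | apply: (domZ hA)].
rewrite -!(tscaleA hA) // (mulrC c a) (mulrC c b).
(* Both sides are now sums of the same seven terms, differently ordered: [ab z], [ac y], [a yz],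
   [bc x], [b xz], [c xy] and [xyz]. *)
rewrite (rhoE (domZ hA (a * b) dz)) (rhoE (domZ hA (a * c) dy)) (rhoE (domZ hA a D2))
  (rhoE (domZ hA (b * c) dx)) (rhoE (domZ hA b D3)) (rhoE (domZ hA c D1)) (rhoE D4).
rewrite -!rhoD; congr rho.
set u1 := emb _; set u2 := emb _; set u3 := emb _; set u4 := emb _.
set u5 := emb _; set u6 := emb _; set u7 := emb _.
rewrite !addrA; congr (_ + _).
rewrite -!addrA; congr (_ + (_ + _)).
by rewrite addrCA; congr (_ + _); rewrite [u5 + u6]addrC addrCA.
Qed.

Lemma amul1 : left_id (aplus_mk 1 (tzero A)) amul.
Proof.
move=> x; apply: aplusP; first by rewrite /= mul1r.
rewrite rho_amul rho_mk ?(tscaler0) ?(tmul0) ?taddr0 ?(tscale1 hA) //; dom.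
Qed.
Lemma amulr1 : right_id (aplus_mk 1 (tzero A)) amul.
Proof.
move=> x; apply: aplusP; first by rewrite /= mulr1.
rewrite rho_amul rho_mk ?(tscaler0) ?(tmulr0) ?taddr0 ?(tscale1 hA) ?(tadd0 hA) //; dom.
Qed.
Lemma aone_neq0 : aplus_mk 1 (tzero A) != 0.
Proof. by apply/eqP => /(congr1 aug) /eqP; rewrite /= oner_eq0. Qed.

HB.instance Definition _ := GRing.Zmodule_isNzRing.Build T
  amulA amul1 amulr1 amulDl amulDr aone_neq0.
End Unitalization.

(** * The group law of GL(A) in matrices over the unitalization *)

Section GLTheory.
Variables (R : realType) (A : talg R) (hA : is_alg A).
Local Notation D := (@tdom R A).
Local Notation T := (aplus hA).
Local Notation ia := (emb hA).

Lemma embM x y : D x -> D y -> ia (tmul x y) = ia x * ia y.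
Proof.
move=> dx dy; have dxy := domM hA dx dy.
apply: aplusP; first by rewrite /= mulr0.
rewrite (rho_amul (ia x) (ia y)) !rho_emb // !(tscale0 hA) // !(tadd0 hA) //.
exact: dom0.
Qed.

Lemma embN x : D x -> ia (topp x) = - ia x.
Proof.
move=> dx; apply: aplusP; first by rewrite /= oppr0.
by rewrite rhoN !rho_emb //; apply: domN.
Qed.

Lemma emb_lmulp lam c a : D c -> D a -> ia (lmulp lam c a) = aplus_mk hA lam c * ia a.
Proof.
move=> dc da; apply: aplusP; first by rewrite /= mulr0.
rewrite (rho_amul (aplus_mk hA lam c) (ia a)) !rho_mk //=; last first.
  by apply: (domD hA); [apply: domZ|apply: domM].
by rewrite (tscale0 hA) // (taddr0 hA) //; apply: domZ.
Qed.

Lemma emb_rmulp lam c a : D c -> D a -> ia (rmulp lam c a) = ia a * aplus_mk hA lam c.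
Proof.
move=> dc da; apply: aplusP; first by rewrite /= mul0r.
rewrite (rho_amul (ia a) (aplus_mk hA lam c)) !rho_mk //=; last first.
  by apply: (domD hA); [apply: domZ|apply: domM].
by rewrite (tscale0 hA) // (tadd0 hA) //; apply: domZ.
Qed.

Lemma emb_inj x y : D x -> D y -> ia x = ia y -> x = y.
Proof. by move=> dx dy /(congr1 (@rho _ _ _)); rewrite !rho_emb. Qed.

Lemma dom_tsum (I : Type) (s : seq I) (F : I -> tcar A) :
  (forall i, D (F i)) -> D (tsum [seq F i | i <- s]).
Proof.
move=> dF; elim: s => [|i s ih]; first exact: dom0.
exact: (domD hA).
Qed.

Lemma emb_tsum (I : Type) (s : seq I) (F : I -> tcar A) :
  (forall i, D (F i)) -> ia (tsum [seq F i | i <- s]) = \sum_(i <- s) ia (F i).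
Proof.
move=> dF; elim: s => [|i s ih]; first by rewrite big_nil.
by rewrite big_cons -ih -embD //; apply: dom_tsum.
Qed.

(** Serves to replace the bounds that [mmul] and [evp1] take from [xget] by any convenient one; the
    extra terms of the longer sum vanish. *)
Lemma tsum_bnd (F : nat -> tcar A) n m : (forall k, D (F k)) ->
  (forall k, (n <= k)%N -> F k = tzero A) ->
  (forall k, (m <= k)%N -> F k = tzero A) ->
  tsum [seq F k | k <- iota 0 n] = tsum [seq F k | k <- iota 0 m].
Proof.
move=> dF; wlog lnm : n m / (n <= m)%N.
  by move=> H h1 h2; case/orP: (leq_total n m) => ?; [|symmetry]; apply: H.
move=> h1 _; apply: emb_inj; try exact: dom_tsum.
have ix k : iota 0 k = index_iota 0 k by rewrite /index_iota subn0.
rewrite !emb_tsum // !ix (big_cat_nat (leq0n n) lnm) /=.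
rewrite [X in _ = _ + X]big_nat_cond [X in _ = _ + X]big1 ?addr0 // => k.
by rewrite andbT => /andP [nk _]; rewrite h1 ?emb0.
Qed.

Definition mdom (M : mat A) := forall i j, D (M i j).

Lemma mvalid_mdom (M : mat A) : mvalid M -> mdom M. Proof. by case. Qed.

Lemma msupp_le n m (M : mat A) : (n <= m)%N -> msupp n M -> msupp m M.
Proof.
by move=> nm h i j /orP[] ij; apply: h; rewrite (leq_trans nm ij) ?orbT.
Qed.

Lemma mbndP (M : mat A) : mvalid M -> msupp (mbnd M) M.
Proof. by case=> -[n hn] _; rewrite /mbnd; case: xgetP => [m _ //|/(_ n)]. Qed.

Lemma mmulE n (M N : mat A) i j : mvalid M -> mdom N -> msupp n M ->
  mmul M N i j = tsum [seq tmul (M i k) (N k j) | k <- iota 0 n].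
Proof.
move=> vM dN sM; apply: (@tsum_bnd (fun k => tmul (M i k) (N k j))) => k.
- by apply: domM => //; case: vM.
- by move=> h; rewrite (mbndP vM) ?h ?orbT // (tmul0 hA).
- by move=> h; rewrite sM ?h ?orbT // (tmul0 hA).
Qed.

(** The corner of [M] alone; the group element it stands for is [1%:M + trunc_mx n M]. *)
Definition trunc_mx n (M : mat A) : 'M[T]_n := \matrix_(i, j) ia (M i j).

Lemma trunc_mx_inj n (M N : mat A) : mdom M -> mdom N -> msupp n M -> msupp n N ->
  trunc_mx n M = trunc_mx n N -> M = N.
Proof.
move=> dM dN sM sN /matrixP e; apply/funext => i; apply/funext => j.
case: (ltnP i n) => hi; last by rewrite sM ?sN ?hi.
case: (ltnP j n) => hj; last by rewrite sM ?sN ?hj ?orbT.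
by have := e (Ordinal hi) (Ordinal hj); rewrite !mxE; apply: emb_inj.
Qed.

Lemma mdom_mmul (M N : mat A) : mdom M -> mdom N -> mdom (mmul M N).
Proof. by move=> dM dN i j; apply: dom_tsum => k; apply: domM. Qed.

Lemma mdom_circ (M N : mat A) : mdom M -> mdom N -> mdom (circ M N).
Proof.
by move=> dM dN i j; apply: (domD hA); [apply: domD|apply: mdom_mmul].
Qed.

Lemma msupp_circ n (M N : mat A) : mvalid M -> mdom N -> msupp n M -> msupp n N ->
  msupp n (circ M N).
Proof.
move=> vM dN sM sN i j ij; rewrite /circ /madd (mmulE _ _ vM dN sM) sM // sN //.
rewrite (tadd0 hA) ?(tadd0 hA); try exact: dom0; last first.
  by apply: dom_tsum => k; apply: domM => //; case: vM.
apply: emb_inj; [by apply: dom_tsum => k; apply: domM => //; case: vM|exact: dom0|].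
rewrite emb_tsum; last by move=> k; apply: domM => //; case: vM.
rewrite big1 // => k _; case/orP: ij => h.
  by rewrite sM ?h // (tmul0 hA).
by rewrite sN ?h ?orbT // (tmulr0 hA) //; case: vM.
Qed.

Lemma mvalid_circ (M N : mat A) : mvalid M -> mvalid N -> mvalid (circ M N).
Proof.
move=> vM [[n sN] dN]; split; last by apply: mdom_circ => //; case: vM.
case: (vM) => -[m sM] _; exists (maxn m n); apply: msupp_circ => //.
  by apply: msupp_le sM; rewrite leq_maxl.
by apply: msupp_le sN; rewrite leq_maxr.
Qed.

(** This is [(1 + M)(1 + N) = 1 + M + N + MN]. The inner sum of [MN] runs over the columns of [M],
    all of which lie in the corner, so truncation loses nothing. *)
Lemma trunc_mx_circ n (M N : mat A) : mvalid M -> mdom N -> msupp n M ->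
  1%:M + trunc_mx n (circ M N) = (1%:M + trunc_mx n M) *m (1%:M + trunc_mx n N).
Proof.
move=> vM dN sM; have dM := mvalid_mdom vM.
rewrite mulmxDr mulmx1 mulmxDl mul1mx addrA -(addrA 1%:M) -addrA -addrA; congr (_ + _).
apply/matrixP => i j; rewrite !mxE /circ /madd addrA (mmulE _ _ vM dN sM).
rewrite !embD //; last 2 first.
- exact: domD.
- by apply: dom_tsum => k; apply: domM.
congr (_ + _); rewrite emb_tsum; last by move=> k; apply: domM.
rewrite -[X in iota 0 X]subn0 -[iota 0 _]/(index_iota 0 n) big_mkord; apply: eq_bigr => k _.
by rewrite embM // !mxE.
Qed.

Lemma mvalid0 : mvalid (mzero A).
Proof. by split; [exists 0%N | move=> i j; apply: dom0]. Qed.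

Lemma trunc_mx0 n : trunc_mx n (mzero A) = 0.
Proof. by apply/matrixP => i j; rewrite !mxE. Qed.

Lemma circ0m (M : mat A) : mvalid M -> circ (mzero A) M = M.
Proof.
move=> vM; have [[n sM] dM] := vM.
apply: (@trunc_mx_inj n) => //; first by apply: mdom_circ => //; case: mvalid0.
  by apply: msupp_circ => //; apply: mvalid0.
by apply: (@addrI _ 1%:M); rewrite trunc_mx_circ ?trunc_mx0 ?addr0 ?mul1mx //; apply: mvalid0.
Qed.

Lemma circm0 (M : mat A) : mvalid M -> circ M (mzero A) = M.
Proof.
move=> vM; have [[n sM] dM] := vM; have [_ d0] := mvalid0.
apply: (@trunc_mx_inj n) => //; first by apply: mdom_circ => //; case: mvalid0.
  by apply: msupp_circ.
by apply: (@addrI _ 1%:M); rewrite trunc_mx_circ ?trunc_mx0 ?addr0 ?mulmx1.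
Qed.

(** All products live in one corner containing the three supports, where associativity is that of
    [*m]. *)
Lemma circA (M N P : mat A) : mvalid M -> mvalid N -> mvalid P ->
  circ M (circ N P) = circ (circ M N) P.
Proof.
move=> vM vN vP; have [[m sM] dM] := vM; have [[n sN] dN] := vN.
have [[p sP] dP] := vP; pose q := maxn m (maxn n p).
have {}sM : msupp q M by apply: msupp_le sM; rewrite leq_maxl.
have {}sN : msupp q N by apply: msupp_le sN; rewrite /q maxnCA leq_maxl.
have {}sP : msupp q P by apply: msupp_le sP; rewrite /q maxnA leq_maxr.
have vNP := mvalid_circ vN vP; have vMN := mvalid_circ vM vN.
have sMN := msupp_circ vM dN sM sN; have sNP := msupp_circ vN dP sN sP.
have [_ dMN] := vMN; have [_ dNP] := vNP.
apply: (@trunc_mx_inj q); try exact: mdom_circ; try exact: msupp_circ.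
by apply: (@addrI _ 1%:M); rewrite !trunc_mx_circ // mulmxA.
Qed.

Lemma qinv_sym (M N : mat A) : mvalid M -> qinv M N -> qinv N M.
Proof. by move=> vM [_ [? ?]]. Qed.

Lemma qinv_uniq (M N N' : mat A) : mvalid M -> qinv M N -> qinv M N' -> N = N'.
Proof.
move=> vM [vN [_ h1]] [vN' [h2 _]].
by rewrite -[LHS](circm0 vN) -h2 circA // h1 circ0m.
Qed.

Lemma qinv_circ (M N M' N' : mat A) : mvalid M -> mvalid N ->
  qinv M M' -> qinv N N' -> qinv (circ M N) (circ N' M').
Proof.
move=> vM vN [vM' [h1 h2]] [vN' [h3 h4]].
have vc := mvalid_circ; split; first exact: vc.
split.
  by rewrite -(circA vM vN (vc _ _ vN' vM')) (circA vN) // h3 circ0m.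
by rewrite -(circA vN' vM' (vc _ _ vM vN)) (circA vM') // h2 circ0m.
Qed.

Lemma GL_valid (M : mat A) : GL M -> mvalid M. Proof. by case. Qed.

Lemma qinv_GL (M N : mat A) : GL M -> qinv M N -> GL N.
Proof. by move=> [vM _] h; split; [case: h | exists M; apply: qinv_sym]. Qed.

Lemma GL_circ (M N : mat A) : GL M -> GL N -> GL (circ M N).
Proof.
move=> [vM [M' hM]] [vN [N' hN]]; split; first exact: mvalid_circ.
by exists (circ N' M'); apply: qinv_circ.
Qed.

Lemma qinv0 : qinv (mzero A) (mzero A).
Proof. by split; [exact: mvalid0|rewrite circ0m //; exact: mvalid0]. Qed.

Lemma GL0 : GL (mzero A).
Proof. by split; [exact: mvalid0|exists (mzero A); exact: qinv0]. Qed.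

(** * Elementary matrices and conjugation by them *)

Definition elem_mx n (i j : nat) (x : T) : 'M[T]_n :=
  \matrix_(p, q) if ((p == i :> nat) && (q == j :> nat)) then x else 0.

Lemma mul_elem_mx n i (j : 'I_n) x (M : 'M[T]_n) p q :
  (elem_mx n i j x *m M) p q = if (p == i :> nat) then x * M j q else 0.
Proof.
rewrite mxE (bigD1 j) //= big1 ?addr0; last first.
  by move=> k kj; rewrite mxE (negbTE (kj : k != j :> nat)) andbF mul0r.
by rewrite mxE eqxx andbT; case: eqP => //; rewrite mul0r.
Qed.

Lemma mulr_elem_mx n (i : 'I_n) j x (M : 'M[T]_n) p q :
  (M *m elem_mx n i j x) p q = if (q == j :> nat) then M p i * x else 0.
Proof.
rewrite mxE (bigD1 i) //= big1 ?addr0; last first.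
  by move=> k ki; rewrite mxE (negbTE (ki : k != i :> nat)) mulr0.
by rewrite mxE eqxx /=; case: eqP => //; rewrite mulr0.
Qed.

Lemma elem_mx_sq n i j x y : i != j -> elem_mx n i j x *m elem_mx n i j y = 0.
Proof.
move=> ij; apply/matrixP => p q; rewrite !mxE big1 // => k _; rewrite !mxE.
have [kj|] := eqVneq (k : nat) j; last by rewrite andbF mul0r.
by rewrite kj (eq_sym j) (negbTE ij) mulr0.
Qed.

(** Since [X] squares to zero, [1 - X] inverts [1 + X] and this is a conjugation. The terms on the
    right are grouped as in [conj_e]: [X M], [M X] and [X M X] are its [X1], [X2] and [X3]. *)
Lemma conj_mx_expand n (X M : 'M[T]_n) : X *m X = 0 ->
  (1%:M + X) *m (1%:M + M) *m (1%:M - X) =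
  1%:M + (M + X *m M - (M *m X + X *m M *m X)).
Proof.
move=> X2.
have -> : (1%:M + X) *m (1%:M + M) = 1%:M + X + (M + X *m M).
  by rewrite mulmxDr mulmx1 mulmxDl mul1mx.
rewrite mulmxBr mulmx1 !mulmxDl mul1mx X2 addr0.
set U := _ + X *m M *m X.
rewrite -!addrA; congr (_ + _); rewrite opprD.
rewrite addrCA; congr (_ + _); rewrite addrCA; congr (_ + _).
by rewrite addrA subrr add0r.
Qed.

Lemma dom_lmulp lam c a : D c -> D a -> D (lmulp lam c a).
Proof. by move=> dc da; apply: (domD hA); [apply: domZ|apply: domM]. Qed.
Lemma dom_rmulp lam c a : D c -> D a -> D (rmulp lam c a).
Proof. by move=> dc da; apply: (domD hA); [apply: domZ|apply: domM]. Qed.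

Lemma mdom_conj i j lam c (M : mat A) : D c -> mdom M -> mdom (conj_e i j lam c M).
Proof.
move=> dc dM p q; rewrite /conj_e.
have d0 := dom0 hA; have dl := @dom_lmulp lam c; have dr := @dom_rmulp lam c.
apply: (domD hA); first by apply: (domD hA) => //; case: ifP => _ //; apply: dl.
apply: (domN hA); apply: (domD hA); case: ifP => _ //; apply: dr => //.
exact: dl.
Qed.

(** Confirms that the entrywise formula [conj_e] is conjugation by [1 + x E_ij] with [x = (lam, c)],
    once the corner contains both indices. *)
Lemma trunc_mx_conj n (i j : 'I_n) lam c M : val i != val j -> D c -> mdom M ->
  1%:M + trunc_mx n (conj_e i j lam c M) =
  (1%:M + elem_mx n i j (aplus_mk hA lam c)) *m (1%:M + trunc_mx n M) *m
  (1%:M - elem_mx n i j (aplus_mk hA lam c)).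
Proof.
move=> ij dc dM; rewrite conj_mx_expand ?elem_mx_sq //; congr (_ + _).
have d0 := dom0 hA; have dl := @dom_lmulp lam c; have dr := @dom_rmulp lam c.
apply/matrixP => p q; rewrite mxE /conj_e.
rewrite !embD ?embN ?embD; try by
  repeat first [apply: (domN hA) | apply: (domD hA) | case: ifP => _ //;
    do ?[apply: dr|apply: dl] | apply: dM].
rewrite -mulmxA.
have addE (U V : 'M[T]_n) : (U + V) p q = U p q + V p q by rewrite mxE.
have oppE (U : 'M[T]_n) : (- U) p q = - U p q by rewrite mxE.
rewrite !addE oppE addE.
rewrite !mul_elem_mx !mulr_elem_mx !mxE.
congr (_ + _ - (_ + _)).
- by case: eqP => // _; rewrite emb_lmulp.
- by case: eqP => // _; rewrite emb_rmulp.
- case: eqP => //= _; case: eqP => // _; rewrite ?mulr0 //.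
  by rewrite emb_rmulp ?emb_lmulp ?mulrA //; apply: dl.
Qed.

Lemma lmulp0 lam c : D c -> lmulp lam c (tzero A) = tzero A.
Proof.
move=> dc; rewrite /lmulp (tscaler0 hA) (tmulr0 hA) // (tadd0 hA) //; exact: dom0.
Qed.
Lemma rmulp0 lam c : D c -> rmulp lam c (tzero A) = tzero A.
Proof.
move=> dc; rewrite /rmulp (tscaler0 hA) (tmul0 hA) // (tadd0 hA) //; exact: dom0.
Qed.

Lemma topp0 : topp (tzero A) = tzero A.
Proof.
have d0 := dom0 hA; have dN := domN hA d0.
by apply: (emb_inj dN d0); rewrite embN // emb0 oppr0.
Qed.

Lemma msupp_conj n i j lam c (M : mat A) : (i < n)%N -> (j < n)%N -> D c ->
  msupp n M -> msupp n (conj_e i j lam c M).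
Proof.
move=> hi hj dc sM p q pq; rewrite /conj_e sM //.
have d0 := dom0 hA.
have e1 : (if p == i then lmulp lam c (M j q) else tzero A) = tzero A.
  case: eqP => // pi; rewrite sM ?lmulp0 //.
  by case/orP: pq => [|->]; rewrite ?orbT // pi leqNgt hi.
have e2 : (if q == j then rmulp lam c (M p i) else tzero A) = tzero A.
  case: eqP => // qj; rewrite sM ?rmulp0 //.
  by case/orP: pq => [->|] //; rewrite qj leqNgt hj.
have e3 : (p == i) && (q == j) = false.
  by apply/negP => /andP [/eqP pi /eqP qj]; move: pq; rewrite pi qj leqNgt hi leqNgt hj.
by rewrite e1 e2 e3 !(tadd0 hA) // topp0.
Qed.

Lemma mvalid_conj i j lam c (M : mat A) : D c -> mvalid M -> mvalid (conj_e i j lam c M).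
Proof.
move=> dc [[n sM] dM]; split; last exact: mdom_conj.
exists (maxn n (maxn i.+1 j.+1)); apply: msupp_conj => //.
- by rewrite !leq_max leqnn orbT.
- by rewrite !leq_max leqnn !orbT.
- by apply: msupp_le sM; rewrite leq_maxl.
Qed.

(** In a corner containing [i], [j] and both supports, the inner factors [(1 - E)(1 + E)] cancel.
    Stability of [GL] under [conj_e] follows. *)
Lemma conj_circ i j lam c (M N : mat A) : i != j -> D c -> mvalid M -> mvalid N ->
  circ (conj_e i j lam c M) (conj_e i j lam c N) = conj_e i j lam c (circ M N).
Proof.
move=> ij dc vM vN; have [[m sM] dM] := vM; have [[n sN] dN] := vN.
pose q := maxn (maxn m n) (maxn i.+1 j.+1).
have hi : (i < q)%N by rewrite !leq_max leqnn !orbT.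
have hj : (j < q)%N by rewrite !leq_max leqnn !orbT.
have {}sM : msupp q M by apply: msupp_le sM; rewrite !leq_max leqnn.
have {}sN : msupp q N by apply: msupp_le sN; rewrite !leq_max leqnn !orbT.
have vMN := mvalid_circ vM vN; have dMN := mvalid_mdom vMN.
have vcM := mvalid_conj i j lam dc vM; have dcM := mvalid_mdom vcM.
have dcN := mdom_conj i j lam dc dN.
have scM := msupp_conj lam hi hj dc sM; have scN := msupp_conj lam hi hj dc sN.
apply: (@trunc_mx_inj q).
- exact: mdom_circ.
- exact: mdom_conj.
- exact: msupp_circ.
- by apply: msupp_conj => //; apply: msupp_circ.
apply: (@addrI _ 1%:M); rewrite trunc_mx_circ //.
have t := @trunc_mx_conj q (Ordinal hi) (Ordinal hj) lam c; rewrite /= in t.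
rewrite !t // trunc_mx_circ //; set E := elem_mx _ _ _ _.
have EE : (1%:M - E) *m (1%:M + E) = 1%:M.
  by rewrite mulmxDl mul1mx mulNmx mulmxDr mulmx1 elem_mx_sq // addr0 addrK.
by rewrite !mulmxA -(mulmxA _ (1%:M - E) (1%:M + E)) EE mulmx1.
Qed.

Lemma conj_e0 i j lam c : D c -> conj_e i j lam c (mzero A) = mzero A.
Proof.
move=> dc; apply/funext => p; apply/funext => q.
rewrite /conj_e /mzero rmulp0 // lmulp0 // rmulp0 // !if_same.
by rewrite !(tadd0 hA) ?topp0 //; exact: dom0.
Qed.

Lemma GL_conj i j lam c (M : mat A) : i != j -> D c -> GL M -> GL (conj_e i j lam c M).
Proof.
move=> ij dc [vM [N [vN [h1 h2]]]]; split; first exact: mvalid_conj.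
exists (conj_e i j lam c N); split; first exact: mvalid_conj.
by rewrite !conj_circ // h1 h2 conj_e0.
Qed.

Lemma mvalid_elm i j a : D a -> mvalid (elm i j a).
Proof.
move=> da; split; last by move=> p q; rewrite /elm; case: ifP => // _; apply: dom0.
exists (maxn i.+1 j.+1) => p q pq; rewrite /elm; case: andP => // -[/eqP pi /eqP qj].
by move: pq; rewrite pi qj !geq_max !ltnn !andbF.
Qed.

Lemma trunc_mx_elm n i j a : trunc_mx n (elm i j a) = elem_mx n i j (ia a).
Proof. by apply/matrixP => p q; rewrite !mxE /elm; case: ifP. Qed.

Lemma elm0 i j : elm i j (tzero A) = mzero A.
Proof. by apply/funext => p; apply/funext => q; rewrite /elm if_same. Qed.

Lemma circ_elm i j a b : i != j -> D a -> D b ->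
  circ (elm i j a) (elm i j b) = elm i j (tadd a b).
Proof.
move=> ij da db; have va := mvalid_elm i j da; have vb := mvalid_elm i j db.
have vc := mvalid_elm i j (domD hA da db).
have [[m sa] da'] := va; have [[n sb] db'] := vb; have [[p sc] dc'] := vc.
pose q := maxn m (maxn n p).
have {}sa := msupp_le (leq_maxl _ _ : (m <= q)%N) sa.
have {}sb : msupp q (elm i j b) by apply: msupp_le sb; rewrite /q maxnCA leq_maxl.
have {}sc : msupp q (elm i j (tadd a b)) by apply: msupp_le sc; rewrite /q maxnA leq_maxr.
apply: (@trunc_mx_inj q) => //; try exact: mdom_circ; try exact: msupp_circ.
apply: (@addrI _ 1%:M); rewrite trunc_mx_circ // !trunc_mx_elm.
rewrite mulmxDr mulmx1 mulmxDl mul1mx elem_mx_sq // addr0 -addrA; congr (_ + _).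
apply/matrixP => r s; rewrite !mxE embD //.
by case: ifP; rewrite ?addr0.
Qed.

Lemma GL_elm i j a : i != j -> D a -> GL (elm i j a).
Proof.
move=> ij da; split; first exact: mvalid_elm.
have dN := domN hA da.
exists (elm i j (topp a)); split; first exact: mvalid_elm.
by rewrite !circ_elm // (taddC hA da dN) (taddN hA) // elm0.
Qed.

End GLTheory.

(** * Functoriality of GL for algebra homomorphisms *)

Definition is_ahom (R : realType) (A B : talg R) (f : tcar A -> tcar B) : Prop :=
  [/\ forall x, tdom x -> tdom (f x),
      forall x y, tdom x -> tdom y -> f (tadd x y) = tadd (f x) (f y),
      forall x y, tdom x -> tdom y -> f (tmul x y) = tmul (f x) (f y) &
      forall c x, tdom x -> f (tscale c x) = tscale c (f x)].

Lemma hom_ahom (R : realType) (A B : talg R) (f : tcar A -> tcar B) :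
  is_hom f -> is_ahom f.
Proof. by case=> h1 [h2 [h3 _]]; split=> // x y dx dy; case: (h2 x y dx dy). Qed.

Section Functoriality.
Variables (R : realType) (A B : talg R) (hA : is_alg A) (hB : is_alg B).
Variables (f : tcar A -> tcar B) (hf : is_ahom f).
Local Notation D := (@tdom R A).

Lemma ahom0 : f (tzero A) = tzero B.
Proof.
have [fd _ _ fZ] := hf; have d0 := dom0 hA.
by rewrite -(tscale0 hA d0) fZ // (tscale0 hB) //; apply: fd.
Qed.

Lemma ahomN x : D x -> f (topp x) = topp (f x).
Proof.
move=> dx; have [fd fD _ _] := hf; have dN := domN hA dx.
apply: (emb_inj (hA := hB)); [by apply: fd|by apply: (domN hB); apply: fd|].
apply: (@addIr _ (emb hB (f x))); rewrite embN; last exact: fd.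
by rewrite addNr -embD -?fD ?(taddN hA) ?ahom0 ?emb0 //; apply: fd.
Qed.

Lemma ahom_tsum (I : Type) (s : seq I) (F : I -> tcar A) :
  (forall i, D (F i)) -> f (tsum [seq F i | i <- s]) = tsum [seq f (F i) | i <- s].
Proof.
move=> dF; have [_ fD _ _] := hf; elim: s => [|i s ih]; first exact: ahom0.
by rewrite /= fD ?ih //; apply: (dom_tsum hA).
Qed.

Lemma mmap_supp n (M : mat A) : msupp n M -> msupp n (mmap f M).
Proof. by move=> sM i j ij; rewrite /mmap sM // ahom0. Qed.

Lemma mmap_valid (M : mat A) : mvalid M -> mvalid (mmap f M).
Proof.
case=> -[n sM] dM; split; first by exists n; apply: mmap_supp.
by have [fd _ _ _] := hf => i j; apply: fd.
Qed.

Lemma mmap0 : mmap f (mzero A) = mzero B.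
Proof. by apply/funext => i; apply/funext => j; apply: ahom0. Qed.

(** The bounds chosen for [M] and for its image may differ, so both products are first rewritten
    with one common support bound [n]. *)
Lemma mmap_circ (M N : mat A) : mvalid M -> mvalid N ->
  mmap f (circ M N) = circ (mmap f M) (mmap f N).
Proof.
move=> vM vN; have [fd fD fM _] := hf; have [[n sM] dM] := vM.
have [_ dN] := vN; have vfM := mmap_valid vM; have [_ dfN] := mmap_valid vN.
apply/funext => i; apply/funext => j; rewrite /circ /madd {1}/mmap.
rewrite (mmulE hA _ _ vM dN sM) (mmulE hB _ _ vfM dfN (mmap_supp sM)).
rewrite !fD //; last 2 first.
- exact: (domD hA).
- by apply: (dom_tsum hA) => k; apply: (domM hA).
rewrite ahom_tsum; last by move=> k; apply: (domM hA).
by congr (tadd _ (tsum _)); apply: eq_map => k; rewrite fM.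
Qed.

Lemma mmap_qinv (M N : mat A) : mvalid M -> qinv M N -> qinv (mmap f M) (mmap f N).
Proof.
move=> vM [vN [h1 h2]]; split; first exact: mmap_valid.
by rewrite -!mmap_circ // h1 h2 mmap0.
Qed.

Lemma mmap_GL (M : mat A) : GL M -> GL (mmap f M).
Proof.
move=> [vM [N h]]; split; first exact: mmap_valid.
by exists (mmap f N); apply: mmap_qinv.
Qed.

Lemma mmap_elm i j a : mmap f (elm i j a) = elm i j (f a).
Proof.
apply/funext => p; apply/funext => q; rewrite /mmap /elm.
by case: ifP => // _; rewrite ahom0.
Qed.

Lemma mmap_conj i j lam c (M : mat A) : D c -> mvalid M ->
  mmap f (conj_e i j lam c M) = conj_e i j lam (f c) (mmap f M).
Proof.
move=> dc [_ dM]; have [fd fD fM fZ] := hf.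
have d0 := dom0 hA.
have dl a : D a -> D (lmulp lam c a) by move=> da; apply: (dom_lmulp hA).
have dr a : D a -> D (rmulp lam c a) by move=> da; apply: (dom_rmulp hA).
have fl a : D a -> f (lmulp lam c a) = lmulp lam (f c) (f a).
  by move=> da; rewrite /lmulp fD ?fZ ?fM //; [apply: (domZ hA)|apply: (domM hA)].
have fr a : D a -> f (rmulp lam c a) = rmulp lam (f c) (f a).
  by move=> da; rewrite /rmulp fD ?fZ ?fM //; [apply: (domZ hA)|apply: (domM hA)].
have fif (b : bool) x : f (if b then x else tzero A) = if b then f x else tzero B.
  by case: b => //; apply: ahom0.
have dif (b : bool) x : D x -> D (if b then x else tzero A) by case: b.
apply/funext => p; apply/funext => q; rewrite /mmap /conj_e.
have D1 := dif (p == i) _ (dl _ (dM j q)).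
have D2 := dif (q == j) _ (dr _ (dM p i)).
have D3 := dif ((p == i) && (q == j)) _ (dr _ (dl _ (dM j i))).
rewrite fD; last 2 first.
- exact: (domD hA).
- by apply: (domN hA); apply: (domD hA).
rewrite fD // ahomN; last exact: (domD hA).
by rewrite fD // !fif fl // fr // fr ?fl //; apply: dl.
Qed.
End Functoriality.

(** * Smoothness of the paths [t |-> q(t) a] *)

Lemma real_complex_cvg (R : realType) (r : R) :
  (fun x : R => (x%:C)%C : (R[i])^o) @ r --> ((r%:C)%C : (R[i])^o).
Proof.
have H := @cvgrPdist_lt R[i] (R[i])^o R (nbhs r) _ (fun x => (x%:C)%C) ((r%:C)%C).
apply: (iffRL (H _)) => e e0; clear H.
(* The order of [R[i]] is partial: a positive element is real, so [e] is an ordinary real radius. *)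
have eE : e = ((complex.Re e)%:C)%C.
  by move: e0; rewrite ltcE /= => /andP [/eqP h _]; case: e h => a b /= ->.
have Re0 : 0 < complex.Re e by move: e0; rewrite ltcE => /andP [].
near=> x; rewrite -raddfB normc_def /= expr0n addr0 sqrtr_sqr eE ltcR.
near: x; exact: (@cvgr_dist_lt _ _ _ (nbhs r) _ id r cvg_id).
Unshelve. all: by end_near. Qed.

Section SmoothPolynomials.
Variables (R : realType) (A : talg R) (tA : is_talg A).
Let hA : is_alg A := talg_alg tA.
Local Notation D := (@tdom R A).

(** Scalar multiplication is continuous only within the pairs whose vector lies in the domain;
    keeping [a] fixed never leaves that set. *)
Lemma tscale_cvg (X : Type) (G : set_system X) (g : X -> R[i]) c a :
  Filter G -> D a -> (g : X -> (R[i])^o) @ G --> (c : (R[i])^o) ->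
  (fun x => tscale (g x) a) @ G --> tscale c a.
Proof.
move=> FG da gc; have [_ [_ [_ [_ [_ [_ [_ sc]]]]]]] := tA.
move/subspace_continuousP: sc => /(_ (c, a) da).
apply: cvg_trans => U hU.
have : (fun x => (g x, a)) @ G --> ((c : (R[i])^o), a).
  by apply: (cvg_pair gc); apply: cvg_cst.
by move=> h; apply: (@filterS _ G FG _ _ _ (h _ hU)) => x; apply.
Qed.

Lemma clamp01_id (t : R) : 0 <= t <= 1 -> clamp01 t = t.
Proof. by case/andP => t0 t1; rewrite /clamp01 (min_r t1) (max_r t0). Qed.

Lemma clamp01_itv (t : R) : 0 <= clamp01 t <= 1.
Proof. by rewrite /clamp01 le_max lexx /= ge_max ler01 ge_min lexx. Qed.

Lemma clamp01_continuous : continuous (@clamp01 R).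
Proof.
move=> t.
have c0 (c : R) : {for t, continuous (fun _ : R => c : R^o)} by exact: cvg_cst.
have c1 : {for t, continuous (fun s : R => s : R^o)} by exact: cvg_id.
exact: (continuous_max (c0 0) (continuous_min (c0 1) c1)).
Qed.

(* The jet of [t |-> q(t) a] on [I]. *)
Definition mono_jet (q : {poly R}) (a : tcar A) : nat -> R -> tcar A :=
  fun k t => tscale ((q^`(k).[clamp01 t])%:C)%C a.

Lemma mono_jet_smooth q a : D a -> is_smooth_jet (mono_jet q a).
Proof.
move=> da k; split=> [t|].
  by rewrite /mono_jet (clamp01_id (clamp01_itv t)).
split=> [t|]; first exact: (domZ hA).
split=> [t|t t01].
  apply: (@tscale_cvg _ _ (fun x => ((q^`(k).[clamp01 x])%:C)%C)) => //.
  apply: (@cvg_comp _ _ _ (fun x => q^`(k).[clamp01 x]) (fun x => (x%:C)%C)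
    _ _ _ _ (@real_complex_cvg R _)).
  apply: (@cvg_comp _ _ _ (@clamp01 R) (fun x => q^`(k).[x])); last first.
    exact: continuous_horner.
  exact: clamp01_continuous.
rewrite [mono_jet q a k.+1 t]/mono_jet (clamp01_id t01) derivnS.
set p := q^`(k).
(* The difference quotient of the scalar polynomial converges in [R]; the limit is then carried to
   [R[i]] and to [A]. *)
have hp : (fun h : R => h^-1 * (p.[t + h] - p.[t])) @ 0^' --> p^`().[t].
  have dp : derivable (horner p) t 1 by exact: derivable_horner.
  have -> : p^`().[t] = 'D_1 (horner p) t by rewrite derivE derive1E.
  have -> : (fun h : R => h^-1 * (p.[t + h] - p.[t])) =
      (fun h : R => h^-1 *: ((horner p \o shift t) (h *: 1) - horner p t)).
    by apply/funext => h; rewrite /= [h *: 1]mulr1 [t + h]addrC.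
  exact: dp.
have hc : (fun h : R => ((h^-1 * (p.[t + h] - p.[t]))%:C)%C : (R[i])^o)
    @ 0^' --> (((p^`().[t])%:C)%C : (R[i])^o).
  apply: (@cvg_comp _ _ _ _ (fun x => (x%:C)%C : (R[i])^o) _ _ _ hp).
  exact: real_complex_cvg.
move=> U hU;
have h0 : (0^' : set_system R)
    [set h : R | U (tscale ((h^-1 * (p.[t + h] - p.[t]))%:C)%C a)].
  by exact: (tscale_cvg _ da hc hU).
suff : (0^' : set_system R) [set h : R | 0 <= t + h <= 1 ->
    U (tscale ((h^-1)%:C)%C
        (tadd (mono_jet q a k (t + h)) (topp (mono_jet q a k t))))] by [].
apply: (@filterS _ (0^' : set_system R) _ _ _ _ h0) => h /= Uh th.
suff -> : tscale ((h^-1)%:C)%C (tadd (mono_jet q a k (t + h)) (topp (mono_jet q a k t)))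
  = tscale ((h^-1 * (p.[t + h] - p.[t]))%:C)%C a by [].
(* The one-sided restriction enters here: as [t + h] stays in the interval, both clamps
   disappear. *)
rewrite /mono_jet -/p (clamp01_id th) (clamp01_id t01).
set u := p.[t + h]; set v := p.[t].
have dN s : D (tscale s a) by apply: domZ.
have oppE : topp (tscale (v%:C)%C a) = tscale (- (v%:C)%C) a.
  apply: (emb_inj (hA := hA)) => //; first exact: (domN hA).
  apply: (@addIr _ (emb hA (tscale (v%:C)%C a))); rewrite embN // addNr -embD //.
  by rewrite -(tscaleDl hA) // addNr (tscale0 hA).
by rewrite oppE -(tscaleDl hA) // -(tscaleA hA) // -raddfB -rmorphM.
Unshelve. all: by end_near. Qed.

End SmoothPolynomials.

(** Leibniz's rule, with factors kept in order since [S] may be noncommutative. Its binomial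
    coefficients are those of [jet_mul], which is why [poly_jet] is multiplicative. *)
Lemma derivn_mul (S : nzSemiRingType) (p q : {poly S}) n :
  (p * q)^`(n) = \sum_(i < n.+1) (p^`(i) * q^`(n - i)) *+ 'C(n, i).
Proof.
elim: n => [|n ih]; first by rewrite big_ord_recl big_ord0 addr0 mulr1n.
rewrite derivnS ih (raddf_sum (@deriv S)) /=.
pose G j := p^`(j) * q^`(n.+1 - j).
have -> : \sum_(i < n.+1) ((p^`(i) * q^`(n - i)) *+ 'C(n, i))^`() =
    \sum_(i < n.+1) G i.+1 *+ 'C(n, i) + \sum_(i < n.+1) G i *+ 'C(n, i).
  rewrite -big_split; apply: eq_bigr => i _ /=.
  rewrite derivMn derivM mulrnDl /G subSS -!derivnS -subSn //.
  by rewrite -ltnS.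
rewrite [RHS]big_ord_recl /= bin0 mulr1n.
(* Pascal's rule splits the coefficients of order [n + 1]. *)
under [X in _ = _ + X]eq_bigr => i _ do
  rewrite (_ : bump 0 i = i.+1) // binS mulrnDr -/(G i.+1).
rewrite big_split /= [RHS]addrA [LHS]addrC; congr (_ + _).
transitivity (\sum_(i < n.+2) G i *+ 'C(n, i)).
  by rewrite [RHS]big_ord_recr /= bin_small // mulr0n addr0.
by rewrite [LHS]big_ord_recl bin0 mulr1n.
Qed.

(** * Polynomials over the unitalization, their paths, and the algebra [PX A] *)

Section PolynomialPaths.
Variables (R : realType) (A : talg R) (hA : is_alg A).
Local Notation D := (@tdom R A).
Local Notation T := (aplus hA).
Local Notation ia := (emb hA).

(** The scalars of the unitalization. They are central, so evaluating polynomials at them is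
    multiplicative. *)
Definition aplus_const (c : R[i]) : T := aplus_mk hA c (tzero A).

Lemma rho_const c : rho (aplus_const c) = tzero A.
Proof. by rewrite rho_mk //; apply: dom0. Qed.

Lemma aplus_const_mulC c (x : T) : aplus_const c * x = x * aplus_const c.
Proof.
apply: aplusP; first by rewrite /= mulrC.
rewrite (rho_amul (aplus_const c) x) (rho_amul x (aplus_const c)) rho_const /=.
have dx := rho_dom x; have d0 := dom0 hA.
rewrite (tscaler0 hA) (tmul0 hA) // (tmulr0 hA) //; congr tadd.
by rewrite (taddC hA) //; apply: domZ.
Qed.

Lemma rho_constM c (x : T) : rho (aplus_const c * x) = tscale c (rho x).
Proof.
rewrite (rho_amul (aplus_const c) x) rho_const (tscaler0 hA).
have dx := rho_dom x; have dcx := domZ hA c dx.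
by rewrite (tmul0 hA) // !(taddr0 hA).
Qed.

Lemma aplus_constD a b : aplus_const (a + b) = aplus_const a + aplus_const b.
Proof.
by apply: aplusP => //; rewrite rhoD !rho_const (tadd0 hA) //; apply: dom0.
Qed.
Lemma aplus_constM a b : aplus_const (a * b) = aplus_const a * aplus_const b.
Proof. by apply: aplusP => //; rewrite rho_constM !rho_const (tscaler0 hA). Qed.
Lemma aplus_const1 : aplus_const 1 = 1. Proof. by []. Qed.
Lemma aplus_constX a n : aplus_const (a ^+ n) = aplus_const a ^+ n.
Proof. by elim: n => [|n ih]; rewrite ?expr0 // !exprS aplus_constM ih. Qed.
Lemma aplus_constMn a n : aplus_const (a *+ n) = aplus_const a *+ n.
Proof. by elim: n => [|n ih]; rewrite ?mulr0n // !mulrS aplus_constD ih. Qed.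

Lemma emb_rho (x : T) : aug x = 0 -> ia (rho x) = x.
Proof. by move=> h; apply: aplusP => //; rewrite rho_emb //; apply: rho_dom. Qed.

Lemma emb_scale c x : D x -> ia (tscale c x) = aplus_const c * ia x.
Proof.
move=> dx; apply: aplusP; first by rewrite /= mulr0.
by rewrite rho_constM !rho_emb //; apply: domZ.
Qed.

Lemma aug_sum (I : Type) (s : seq I) (P : pred I) (F : I -> T) :
  (forall i, aug (F i) = 0) -> aug (\sum_(i <- s | P i) F i) = 0.
Proof.
by move=> h; elim/big_ind: _ => // x y hx hy; rewrite augD hx hy addr0.
Qed.

Lemma augMn (x : T) n : aug x = 0 -> aug (x *+ n) = 0.
Proof. by move=> h; elim: n => // n ih; rewrite mulrS augD h ih addr0. Qed.

Lemma augMl (x y : T) : aug x = 0 -> aug (x * y) = 0.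
Proof. by rewrite /aug /= -/(aug x) => ->; rewrite mul0r. Qed.

(** Coefficients lie in the ideal [A] of the unitalization. On that ideal [rho] is inverse to [emb],
    hence compatible with products. *)
Definition aug0 (p : {poly T}) := forall i, aug p`_i = 0.

Lemma aug0_derivn p k : aug0 p -> aug0 p^`(k).
Proof. by move=> h i; rewrite coef_derivn; apply: augMn. Qed.

Lemma aug0_horner p x : aug0 p -> aug p.[x] = 0.
Proof.
by move=> h; rewrite horner_coef; apply: aug_sum => i; apply: augMl.
Qed.

Lemma aug0_M p q : aug0 p -> aug0 (p * q).
Proof. by move=> h i; rewrite coefM; apply: aug_sum => j; apply: augMl. Qed.

(* The jet on [I] of [t |-> p(t)]; the coefficients lie in [A] when [aug0 p]. *)
Definition poly_jet (p : {poly T}) : tcar (Ainf A) :=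
  fun k t => rho p^`(k).[aplus_const ((clamp01 t)%:C)%C].

Lemma poly_jetD p q : poly_jet (p + q) = tadd (poly_jet p) (poly_jet q).
Proof.
apply/funext => k; apply/funext => t.
by rewrite /poly_jet derivnD hornerD rhoD.
Qed.

Lemma poly_jetZ c p : poly_jet (aplus_const c *: p) = tscale c (poly_jet p).
Proof.
apply/funext => k; apply/funext => t.
by rewrite /poly_jet derivnZ hornerZ rho_constM.
Qed.

Lemma poly_jet0 : poly_jet 0 = tzero (Ainf A).
Proof.
apply/funext => k; apply/funext => t.
by rewrite /poly_jet linear0 horner0 rho0.
Qed.

Lemma poly_jetM p q : aug0 p -> aug0 q -> poly_jet (p * q) = tmul (poly_jet p) (poly_jet q).
Proof.
move=> hp hq; apply/funext => k; apply/funext => t.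
rewrite /poly_jet derivn_mul horner_sum /= /jet_mul; set x := aplus_const _.
have dF i : D (tscale ('C(k, i))%:R (tmul (rho p^`(i).[x]) (rho q^`(k - i).[x]))).
  by apply: (domZ hA); apply: (domM hA); apply: rho_dom.
apply: (emb_inj (hA := hA)); [exact: rho_dom|exact: dom_tsum|].
have aF (i : 'I_k.+1) : aug ((p^`(i) * q^`(k - i)) *+ 'C(k, i)).[x] = 0.
  by rewrite hornerMn; apply: augMn; apply: aug0_horner; apply: aug0_M; apply: aug0_derivn.
rewrite emb_rho; last exact: aug_sum.
rewrite (emb_tsum hA _ dF) -[X in iota 0 X]subn0 -[iota 0 _]/(index_iota 0 k.+1) big_mkord.
apply: eq_bigr => i _.
rewrite emb_scale; last by apply: (domM hA); apply: rho_dom.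
rewrite embM; try exact: rho_dom.
rewrite !emb_rho; try by apply: aug0_horner; apply: aug0_derivn.
(* Centrality of the evaluation point [x] makes evaluation multiplicative over a noncommutative
   ring. *)
rewrite hornerMn hornerM_comm; last by rewrite /comm_poly aplus_const_mulC.
by rewrite (aplus_constMn 1) aplus_const1 mulr_natl.
Qed.

Lemma poly_jet_ev0 p : ev0 (poly_jet p) = rho p`_0.
Proof.
rewrite /ev0 /poly_jet clamp01_id ?lexx ?ler01 //= -horner_coef0.
by congr (rho _.[_]).
Qed.

Lemma poly_jet_ev1 p : ev1 (poly_jet p) = rho p.[1].
Proof. by rewrite /ev1 /poly_jet clamp01_id ?lexx ?ler01. Qed.

Lemma poly_jet_monomial i (c : T) : aug c = 0 ->
  poly_jet (c *: 'X^i) = mono_jet 'X^i (rho c).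
Proof.
move=> hc; apply/funext => k; apply/funext => t.
rewrite /poly_jet /mono_jet derivnZ hornerZ !derivnXn !hornerMn !hornerXn.
by rewrite -aplus_constX -aplus_constMn -aplus_const_mulC rho_constM rmorphMn rmorphXn.
Qed.

(** A sum of monomial paths; closure of smooth jets under addition is part of [is_alg (Ainf A)]. *)
Lemma poly_jet_smooth p : is_talg A -> is_alg (Ainf A) -> aug0 p ->
  is_smooth_jet (poly_jet p).
Proof.
move=> tA hI hp; rewrite -(coefK p) poly_def.
elim/big_ind: _ => [|x y hx hy|i _].
- by rewrite poly_jet0; exact: (dom0 hI).
- by rewrite poly_jetD; exact: (domD hI).
- by rewrite poly_jet_monomial //; apply: mono_jet_smooth => //; apply: rho_dom.
Qed.

Definition PXpoly (p : tcar (PX A)) : {poly T} := \poly_(i < (pbnd p).+1) ia (p i).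

Lemma pbndP (p : tcar (PX A)) : tdom p -> poly_fin (pbnd p) p.
Proof. by case=> _ [_ [d hd]]; rewrite /pbnd; case: xgetP => [m _ //|/(_ d)]. Qed.

Lemma PXpolyE (p : tcar (PX A)) i : tdom p -> (PXpoly p)`_i = ia (p i).
Proof.
by move=> dp; rewrite coef_poly; case: ltnP => // h; rewrite (pbndP dp).
Qed.

Lemma PXdom (p : tcar (PX A)) i : tdom p -> D ((p : tcar (PX A)) i). Proof. by case=> _ []. Qed.

Lemma PXpoly_aug0 (p : tcar (PX A)) : aug0 (PXpoly p).
Proof. by move=> i; rewrite coef_poly; case: ifP. Qed.

Lemma PXpoly_inj (p q : tcar (PX A)) : tdom p -> tdom q -> PXpoly p = PXpoly q -> p = q.
Proof.
move=> dp dq e; apply/funext => i.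
by apply: (emb_inj (hA := hA)); try exact: PXdom; rewrite -!PXpolyE // e.
Qed.

Lemma PX_mulE (p q : tcar (PX A)) i : tdom p -> tdom q ->
  ia ((tmul p q : tcar (PX A)) i) = (PXpoly p * PXpoly q)`_i.
Proof.
move=> dp dq; have dF j : D (tmul (p j) (q (i - j)%N)).
  by apply: (domM hA); apply: PXdom.
rewrite -[LHS]/(ia (tsum [seq tmul (p j) (q (i - j)%N) | j <- iota 0 i.+1])).
rewrite (emb_tsum hA _ dF) -[X in iota 0 X]subn0 -[iota 0 _]/(index_iota 0 i.+1) big_mkord.
rewrite coefM; apply: eq_bigr => j _.
by rewrite !PXpolyE // embM //; apply: PXdom.
Qed.

Lemma PX_domD (p q : tcar (PX A)) : tdom p -> tdom q -> tdom (tadd p q : tcar (PX A)).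
Proof.
move=> [p0 [dp [m hm]]] [q0 [dq [n hn]]]; have d0 := dom0 hA.
split; first by rewrite /= p0 q0 (tadd0 hA).
split; first by move=> k; apply: (domD hA).
exists (maxn m n) => k; rewrite gtn_max => /andP [mk nk] /=.
by rewrite hm // hn // (tadd0 hA).
Qed.

Lemma PX_domN (p : tcar (PX A)) : tdom p -> tdom (topp p : tcar (PX A)).
Proof.
move=> [p0 [dp [m hm]]]; split; first by rewrite /= p0 (topp0 hA).
split; first by move=> k; apply: (domN hA).
by exists m => k mk /=; rewrite hm // (topp0 hA).
Qed.

Lemma PX_domZ c (p : tcar (PX A)) : tdom p -> tdom (tscale c p : tcar (PX A)).
Proof.
move=> [p0 [dp [m hm]]]; split; first by rewrite /= p0 (tscaler0 hA).
split; first by move=> k; apply: (domZ hA).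
by exists m => k mk /=; rewrite hm // (tscaler0 hA).
Qed.

Lemma PX_domM (p q : tcar (PX A)) : tdom p -> tdom q -> tdom (tmul p q : tcar (PX A)).
Proof.
move=> dp dq; have dM k : D ((tmul p q : tcar (PX A)) k).
  by apply: (dom_tsum hA) => j; apply: (domM hA); apply: PXdom.
have d0 := dom0 hA; split.
  apply: (emb_inj (hA := hA)) => //; rewrite PX_mulE // coefM big_ord_recl big_ord0.
  by rewrite PXpolyE //; case: (dp) => -> _; rewrite emb0 mul0r addr0.
split=> //; exists (size (PXpoly p * PXpoly q)) => k hk.
by apply: (emb_inj (hA := hA)) => //; rewrite PX_mulE // nth_default // ltnW.
Qed.

Lemma PXpolyD (p q : tcar (PX A)) : tdom p -> tdom q -> PXpoly (tadd p q) = PXpoly p + PXpoly q.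
Proof.
move=> dp dq; apply/polyP => i; rewrite coefD !PXpolyE //; last exact: PX_domD.
by rewrite embD //; apply: PXdom.
Qed.

Lemma PXpolyM (p q : tcar (PX A)) : tdom p -> tdom q -> PXpoly (tmul p q) = PXpoly p * PXpoly q.
Proof.
by move=> dp dq; apply/polyP => i; rewrite PXpolyE ?PX_mulE //; apply: PX_domM.
Qed.

Lemma PXpolyZ c (p : tcar (PX A)) : tdom p -> PXpoly (tscale c p) = aplus_const c *: PXpoly p.
Proof.
move=> dp; apply/polyP => i; rewrite coefZ !PXpolyE //; last exact: PX_domZ.
by rewrite emb_scale //; apply: PXdom.
Qed.

(** The additive and scalar laws hold coefficientwise. Those involving the convolution product are
    pulled back from the polynomial ring along the injection [PXpoly]. *)
Lemma PX_alg : is_alg (PX A).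
Proof.
have dD := PX_domD; have dM := PX_domM; have dN := PX_domN; have dZ := PX_domZ.
have d0 := dom0 hA.
split; first by split; [split; [|split=> //; exists 0%N]|split; [split; auto|auto]].
split.
  move=> p q r dp dq dr; have pd i := PXdom i dp; have qd i := PXdom i dq.
  have rd i := PXdom i dr.
  split; first by apply/funext => i; apply: (taddA hA).
  split; first by apply/funext => i; apply: (taddC hA).
  by split; apply/funext => i; [apply: (tadd0 hA)|apply: (taddN hA)].
split.
  move=> a b p q dp dq; have pd i := PXdom i dp; have qd i := PXdom i dq.
  split; first by apply/funext => i; apply: (tscale1 hA).
  split; first by apply/funext => i; apply: (tscaleA hA).
  by split; apply/funext => i; [apply: (tscaleDr hA)|apply: (tscaleDl hA)].
have pc c p : p * (aplus_const c)%:P = (aplus_const c)%:P * p :> {poly T}.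
  by apply/polyP => i; rewrite coefMC coefCM aplus_const_mulC.
move=> a p q r dp dq dr; have dpq := dM _ _ dp dq; have dpr := dM _ _ dp dr.
have dqr := dM _ _ dq dr; have dap := dZ a _ dp; have daq := dZ a _ dq.
have dpDq := dD _ _ dp dq; have dqDr := dD _ _ dq dr.
split; first by apply: PXpoly_inj; auto; rewrite !PXpolyM // mulrA.
split; first by apply: PXpoly_inj; auto; rewrite !(PXpolyM,PXpolyD) // mulrDr.
split; first by apply: PXpoly_inj; auto; rewrite !(PXpolyM,PXpolyD) // mulrDl.
split; apply: PXpoly_inj; auto; rewrite PXpolyM // !PXpolyZ // PXpolyM //.
  by rewrite scalerAl.
by rewrite -!mul_polyC mulrA pc mulrA.
Qed.

Lemma evp1E (p : tcar (PX A)) : tdom p -> evp1 p = rho (PXpoly p).[1].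
Proof.
move=> dp; rewrite /evp1; apply: (emb_inj (hA := hA)).
- by apply: (dom_tsum hA) => i; apply: PXdom.
- exact: rho_dom.
rewrite emb_rho; last by apply: aug0_horner; apply: PXpoly_aug0.
rewrite (emb_tsum hA _ (fun i => PXdom i dp)) horner_poly.
rewrite -[X in iota 0 X]subn0 -[iota 0 _]/(index_iota 0 (pbnd p).+1) big_mkord.
by apply: eq_bigr => i _; rewrite expr1n mulr1.
Qed.

(** For comparing [evp1] before and after a homomorphism is applied to the coefficients, which may
    change the bound chosen by [pbnd]. *)
Lemma evp1_bnd (p : tcar (PX A)) d : tdom p -> poly_fin d p ->
  evp1 p = tsum [seq p k | k <- iota 0 d.+1].
Proof.
move=> dp hd; rewrite /evp1; apply: (tsum_bnd hA) => [k|k|k].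
- exact: PXdom.
- exact: pbndP.
- exact: hd.
Qed.

Lemma evp1_ahom : is_ahom (@evp1 R A).
Proof.
have a0 := PXpoly_aug0.
split=> [p dp|p q dp dq|p q dp dq|c p dp].
- by rewrite evp1E //; apply: rho_dom.
- by rewrite !evp1E ?PXpolyD ?hornerD ?rhoD //; apply: PX_domD.
- rewrite !evp1E ?PXpolyM //; last exact: PX_domM.
  rewrite hornerM_comm; last by rewrite /comm_poly mul1r mulr1.
  have e u : ia (rho (PXpoly u).[1]) = (PXpoly u).[1] by rewrite emb_rho ?aug0_horner.
  by rewrite -[in LHS]e -[X in _ * X]e -embM ?rho_emb //;
    try apply: (domM hA); apply: rho_dom.
- by rewrite !evp1E ?PXpolyZ ?hornerZ ?rho_constM //; apply: PX_domZ.
Qed.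

End PolynomialPaths.

(** * The subgroup [Nsm] of end points of smooth paths *)

Section SmoothK1.
Variables (R : realType) (A : talg R) (tA : is_talg A) (hI : is_alg (Ainf A)).
Let hA : is_alg A := talg_alg tA.

Lemma ev_ahom (t : R) : is_ahom (fun F : tcar (Ainf A) => F 0%N t).
Proof.
have dI (F : tcar (Ainf A)) : tdom F -> tdom (F 0%N t).
  by move=> /(_ 0%N) [_ []].
split=> // F G dF dG; rewrite /= /jet_mul /= subn0.
have dM := domM hA (dI _ dF) (dI _ dG).
by rewrite bin0 (tscale1 hA) // (taddr0 hA).
Qed.

Lemma ev_continuous (t : R) : continuous (fun F : tcar (Ainf A) => F 0%N t).
Proof.
pose jets := (fun F => F) : tcar (Ainf A) ->
  prod_topology (fun _ : nat => {compact-open, R -> tcar A}).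
have c1 : continuous jets by apply: initial_continuous.
have c2 : continuous (fun F => jets F 0%N).
  by move=> F; apply: (@continuous_comp _ _ _ jets (fun G => G 0%N));
    [exact: c1|exact: proj_continuous].
have c3 : continuous (fun g : {compact-open, R -> tcar A} => g t).
  (* Evaluation at [t] is continuous for the compact-open topology because [[set t]] is compact. *)
  apply/continuousP => O oO.
  have := @compact_open_open R (tcar A) [set t] O (@compact_set1 _ t) oO.
  by congr open; apply/seteqP; split=> g /=; rewrite image_set1 sub1set inE.
move=> F; apply: (@continuous_comp _ _ _ (fun F => jets F 0%N) (fun g => g t)).
  exact: c2.
exact: c3.
Qed.

Lemma ev_hom (t : R) : is_hom (fun F : tcar (Ainf A) => F 0%N t).
Proof.
have [h1 h2 h3 h4] := ev_ahom t; split=> //; split=> [x y dx dy|].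
  by split; [apply: h2|apply: h3].
by split=> //; apply: continuous_subspaceT; apply: ev_continuous.
Qed.

Let ev0h : is_ahom (@ev0 R A) := ev_ahom 0.
Let ev1h : is_ahom (@ev1 R A) := ev_ahom 1.

(* If a matrix over [Ainf A] vanishes at 0, then so does its quasi-inverse. *)
Lemma NsmP (M : mat A) : Nsm M <-> exists F : mat (Ainf A),
  [/\ GL F, mmap (@ev0 R A) F = mzero A & M = mmap (@ev1 R A) F].
Proof.
split.
  (* [Ipath A] and [Ainf A] share carrier and operations and differ only in [tdom], so the same
     matrix serves on both sides. *)
  move=> [F [[[sF dF] [G [[sG dG] FG]]] ->]]; exists (F : mat (Ainf A)); split=> //.
    split; first by split=> // i j; case: (dF i j).
    by exists (G : mat (Ainf A)); split=> //; split=> // i j; case: (dG i j).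
  by apply/funext => i; apply/funext => j; case: (dF i j).
move=> [F [[vF [G qG]] F0 ->]]; exists (F : mat (Ipath A)); split=> //.
have [_ [h _]] := mmap_qinv hI hA ev0h vF qG.
have vG : mvalid G by case: qG.
have G0 : mmap (@ev0 R A) G = mzero A.
  by rewrite -h F0 (circ0m hA) //; apply: (mmap_valid hI hA ev0h).
have z (H : mat (Ainf A)) i j : mmap (@ev0 R A) H = mzero A -> H i j 0%N 0 = tzero A.
  by move=> /(congr1 (fun K : mat A => K i j)).
case: vF => sF dF; case: qG => -[sG dG] FG.
split; first by split=> // i j; split; [exact: dF|exact: z].
exists (G : mat (Ipath A)); split=> //.
by split=> // i j; split; [exact: dG|exact: z].
Qed.

(** Taken as a polynomial path of degree 0, so that smoothness and the homomorphism laws are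
    inherited from [poly_jet]. *)
Definition const_path (a : tcar A) : tcar (Ainf A) := poly_jet (emb hA a)%:P.

Lemma aug0_embC (a : tcar A) : aug0 (emb hA a)%:P.
Proof. by move=> i; rewrite coefC; case: ifP. Qed.

Lemma const_path_ahom : is_ahom const_path.
Proof.
split=> [a da|a b da db|a b da db|c a da].
- by apply: (poly_jet_smooth tA hI); apply: aug0_embC.
- by rewrite /const_path embD // polyCD poly_jetD.
- by rewrite /const_path embM // polyCM poly_jetM //; apply: aug0_embC.
- by rewrite /const_path emb_scale // polyCM mul_polyC poly_jetZ.
Qed.

Lemma ev0_const_path (a : tcar A) : tdom a -> ev0 (const_path a) = a.
Proof. by move=> da; rewrite poly_jet_ev0 coefC rho_emb. Qed.

Lemma ev1_const_path (a : tcar A) : tdom a -> ev1 (const_path a) = a.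
Proof. by move=> da; rewrite poly_jet_ev1 hornerC rho_emb. Qed.

(** This is the transformation from polynomial to smooth paths, sending [ax] to [t |-> at]. *)
Lemma poly_path_ahom : is_ahom (fun p : tcar (PX A) => poly_jet (PXpoly hA p)).
Proof.
have a0 := PXpoly_aug0 hA.
split=> [p dp|p q dp dq|p q dp dq|c p dp].
- exact: poly_jet_smooth.
- by rewrite PXpolyD // poly_jetD.
- by rewrite PXpolyM // poly_jetM.
- by rewrite PXpolyZ // poly_jetZ.
Qed.

Lemma Nkv_Nsm (M : mat A) : Nkv M -> Nsm M.
Proof.
move=> [P [gP ->]]; apply/NsmP; have hP := PX_alg hA; have dP := mvalid_mdom (GL_valid gP).
exists (mmap (fun p : tcar (PX A) => poly_jet (PXpoly hA p)) P); split.
- exact: (mmap_GL hP hI poly_path_ahom).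
- apply/funext => i; apply/funext => j; rewrite /mmap poly_jet_ev0.
  by rewrite PXpolyE //; case: (dP i j) => -> _; rewrite rho_emb //; apply: dom0.
- apply/funext => i; apply/funext => j.
  by rewrite /mmap poly_jet_ev1 (evp1E hA).
Qed.

Lemma Nsm_circ (M N : mat A) : Nsm M -> Nsm N -> Nsm (circ M N).
Proof.
move=> /NsmP [F [gF F0 ->]] /NsmP [G [gG G0 ->]]; apply/NsmP; exists (circ F G).
have [vF vG] := (GL_valid gF, GL_valid gG).
split; first exact: (GL_circ hI).
  by rewrite (mmap_circ hI hA ev0h) // F0 G0 (circ0m hA) //; apply: (mvalid0 hA).
by rewrite (mmap_circ hI hA ev1h).
Qed.

(** The inverse path has the right end points because quasi-inverses are unique. *)
Lemma Nsm_qinv (M N : mat A) : Nsm M -> qinv M N -> Nsm N.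
Proof.
move=> /NsmP [F [gF F0 ->]] hN; have [vF [G qG]] := gF.
have e : N = mmap (@ev1 R A) G.
  by apply: (qinv_uniq hA _ hN); [apply: (mmap_valid hI hA ev1h)|apply: (mmap_qinv hI hA ev1h)].
apply/NsmP; exists G; split=> //; first exact: (qinv_GL gF qG).
have := mmap_qinv hI hA ev0h vF qG; rewrite F0 => h.
exact: (qinv_uniq hA (mvalid0 hA) h (qinv0 hA)).
Qed.

Lemma Nsm_GL (M : mat A) : Nsm M -> GL M.
Proof. by move=> /NsmP [F [gF _ ->]]; apply: (mmap_GL hI hA ev1h). Qed.

Lemma Nsm0 : Nsm (mzero A).
Proof.
apply/NsmP; exists (mzero (Ainf A)); split; first exact: (GL0 hI).
  exact: (mmap0 hI hA ev0h).
by rewrite (mmap0 hI hA ev1h).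
Qed.

(** The path is [t |-> e_ij(ta)]. *)
Lemma Nsm_elm i j (a : tcar A) : i != j -> tdom a -> Nsm (elm i j a).
Proof.
move=> ij da; apply/NsmP; exists (elm i j (mono_jet 'X a : tcar (Ainf A))); split.
- apply: (GL_elm hI) => //; exact: mono_jet_smooth.
- rewrite (mmap_elm hI hA ev0h) /ev0 /mono_jet clamp01_id ?lexx ?ler01 //=.
  by rewrite hornerX (tscale0 hA) // elm0.
- rewrite (mmap_elm hI hA ev1h) /ev1 /mono_jet clamp01_id ?lexx ?ler01 //=.
  by rewrite hornerX (tscale1 hA).
Qed.

(** A path ending at [M] is conjugated by [1 + x E_ij], with the [A]-component of [x] replaced by a
    constant path; the start 1 stays fixed. *)
Lemma Nsm_conj i j lam c (M : mat A) : i != j -> tdom c -> Nsm M ->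
  Nsm (conj_e i j lam c M).
Proof.
move=> ij dc /NsmP [F [gF F0 ->]]; apply/NsmP.
have dcc : tdom (const_path c) by case: const_path_ahom => h _ _ _; apply: h.
have vF := GL_valid gF.
exists (conj_e i j lam (const_path c) F); split; first exact: (GL_conj hI).
- by rewrite (mmap_conj hI hA ev0h) // F0 ev0_const_path // (conj_e0 hA).
- by rewrite (mmap_conj hI hA ev1h) // ev1_const_path.
Qed.

Lemma Erel_Nsm (M : mat A) : Erel M -> Nsm M.
Proof.
apply.
- exact: Nsm_elm.
- exact: Nsm_circ.
- exact: Nsm_qinv.
- by move=> i j lam c M1 ij dc; apply: Nsm_conj.
Qed.
End SmoothK1.

(** * Subgroup property and naturality of [Erel] and [Nkv] *)

Definition is_subGL (R : realType) (A : talg R) (N : set (mat A)) : Prop :=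
  [/\ forall M, N M -> GL M, N (mzero A),
      forall M M', N M -> N M' -> N (circ M M') &
      forall M M', N M -> qinv M M' -> N M'].

Lemma Nsm_subGL (R : realType) (A : talg R) : is_talg A -> is_alg (Ainf A) ->
  is_subGL (@Nsm R A).
Proof.
move=> tA hI; split; [exact: Nsm_GL|exact: Nsm0|exact: Nsm_circ|].
by move=> M M'; exact: Nsm_qinv.
Qed.

Lemma Erel_GL (R : realType) (A : talg R) (M : mat A) : is_alg A -> Erel M -> GL M.
Proof.
move=> hA; apply.
- by move=> i j a; apply: GL_elm.
- by move=> M1 M2; apply: GL_circ.
- by move=> M1 M2; apply: qinv_GL.
- by move=> i j lam c M1; apply: GL_conj.
Qed.

Lemma Erel_subGL (R : realType) (A : talg R) : is_alg A -> is_subGL (@Erel R A).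
Proof.
move=> hA; split=> [M|S hel _ _ _|M M' hM hM' S h1 h2 h3 h4|M M' hM hq S h1 h2 h3 h4].
- exact: Erel_GL.
- by rewrite -(elm0 A 0%N 1%N); apply: hel => //; apply: dom0.
- exact: (h2 _ _ (hM S h1 h2 h3 h4) (hM' S h1 h2 h3 h4)).
- exact: (h3 _ _ (hM S h1 h2 h3 h4) hq).
Qed.

Lemma Erel_mmap (R : realType) (A B : talg R) (f : tcar A -> tcar B) (M : mat A) :
  is_alg A -> is_alg B -> is_ahom f -> Erel M -> Erel (mmap f M).
Proof.
move=> hA hB hf; have [_ _ EM EV] := Erel_subGL hB.
(* Membership in [GL] is carried along the induction, since [mmap_circ] and [mmap_qinv] require
   valid matrices. *)
suff h : Erel M -> GL M /\ Erel (mmap f M) by move=> /h [].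
move=> /(_ [set M' | GL M' /\ Erel (mmap f M')]); apply => /=.
- move=> i j a ij da; split; first exact: (GL_elm hA).
  rewrite (mmap_elm hA hB hf) => S hel _ _ _; apply: hel => //.
  by case: hf => fd _ _ _; apply: fd.
- move=> M1 M2 [g1 e1] [g2 e2]; split; first exact: (GL_circ hA).
  rewrite (mmap_circ hA hB hf); [exact: EM|exact: GL_valid|exact: GL_valid].
- move=> M1 M2 [g1 e1] q; split; first exact: (qinv_GL g1 q).
  by apply: EV e1 _; apply: (mmap_qinv hA hB hf) => //; apply: GL_valid.
- move=> i j lam c M1 ij dc [g1 e1]; split; first exact: (GL_conj hA).
  rewrite (mmap_conj hA hB hf) //; last exact: GL_valid.
  move=> S h1 h2 h3 h4; apply: (h4) => //; last exact: (e1 S h1 h2 h3 h4).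
  by case: hf => fd _ _ _; apply: fd.
Qed.

Lemma Nkv_subGL (R : realType) (A : talg R) : is_alg A -> is_subGL (@Nkv R A).
Proof.
move=> hA; have hP := PX_alg hA; have eh := evp1_ahom hA.
split=> [M [P [gP ->]]||M M' [P [gP ->]] [Q [gQ ->]]|M M' [P [gP ->]] hM'].
- exact: (mmap_GL hP hA eh).
- by exists (mzero (PX A)); split; [exact: GL0|rewrite (mmap0 hP hA eh)].
- exists (circ P Q); split; first exact: (GL_circ hP).
  by rewrite (mmap_circ hP hA eh) //; apply: GL_valid.
- have [vP [Q hQ]] := gP; exists Q; split; first exact: (qinv_GL gP hQ).
  by apply: (qinv_uniq hA _ hM'); [apply: (mmap_valid hP hA eh)|apply: (mmap_qinv hP hA eh)].
Qed.

Lemma PX_mmap_ahom (R : realType) (A B : talg R) (f : tcar A -> tcar B) :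
  is_alg A -> is_alg B -> is_ahom f ->
  is_ahom (fun (p : tcar (PX A)) => (fun k => f (p k)) : tcar (PX B)).
Proof.
move=> hA hB hf; have [fd fD fM fZ] := hf; have f0 := ahom0 hA hB hf.
split=> [p [p0 [dp [d hd]]]|p q dp dq|p q dp dq|c p dp].
- split; first by rewrite p0.
  by split; [move=> k; apply: fd|exists d => k dk; rewrite hd].
- by apply/funext => k; apply: fD; apply: PXdom.
- apply/funext => k.
  have dF a : tdom (tmul (p a) (q (k - a)%N)) by apply: (domM hA); apply: PXdom.
  rewrite -[LHS]/(f (tsum [seq tmul (p a) (q (k - a)%N) | a <- iota 0 k.+1])).
  rewrite (ahom_tsum hA hB hf) //; congr tsum; apply: eq_map => a.
  by apply: fM; apply: PXdom.
- by apply/funext => k; apply: fZ; apply: PXdom.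
Qed.

Lemma Nkv_mmap (R : realType) (A B : talg R) (f : tcar A -> tcar B) (M : mat A) :
  is_alg A -> is_alg B -> is_ahom f -> Nkv M -> Nkv (mmap f M).
Proof.
move=> hA hB hf [P [gP ->]]; have hPf := PX_mmap_ahom hA hB hf.
have [_ dP] := GL_valid gP.
exists (mmap (fun (p : tcar (PX A)) => (fun k => f (p k)) : tcar (PX B)) P).
split; first exact: (mmap_GL (PX_alg hA) (PX_alg hB) hPf).
apply/funext => i; apply/funext => j; rewrite /mmap.
have dp := dP i j; have [fd _ _ _] := hPf; have dfp := fd _ dp.
rewrite /evp1 (ahom_tsum hA hB hf); last by move=> k; apply: PXdom.
rewrite -[RHS]/(evp1 _) (evp1_bnd hB dfp (d := pbnd (P i j))) //.
by move=> k hk; rewrite (pbndP dp) // (ahom0 hA hB hf).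
Qed.

(** * Coset sets, chosen representatives and the natural maps *)

Section Quotients.
Variables (R : realType) (A : talg R) (hA : is_alg A).

Lemma nrm_GL (M : mat A) : GL (nrm M).
Proof. by rewrite /nrm; case: asboolP => // _; apply: GL0. Qed.

Lemma nrm_id (M : mat A) : GL M -> nrm M = M.
Proof. by move=> gM; rewrite /nrm asboolT. Qed.

Lemma quot_eq (N : set (mat A)) (X Y : quot N) : proj1_sig X = proj1_sig Y -> X = Y.
Proof.
case: X Y => [X hX] [Y hY] /= e; subst Y; congr exist; exact: Prop_irrelevance.
Qed.

(** [ncls] normalizes its argument by [nrm], which is idempotent, so normalizing the chosen matrix
    does not change its class. *)
Lemma repK (N : set (mat A)) (X : quot N) : qcls N (rep X) = X.
Proof.
apply: quot_eq; rewrite /= [RHS](proj2_sig (cid (proj2_sig X))) /rep.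
by rewrite /ncls nrm_id //; apply: nrm_GL.
Qed.

Lemma rep_GL (N : set (mat A)) (X : quot N) : GL (rep X).
Proof. exact: nrm_GL. Qed.

Lemma ncls_eq (N : set (mat A)) (M M' V : mat A) : is_subGL N ->
  GL M -> GL M' -> qinv M V -> ncls N M = ncls N M' <-> N (circ V M').
Proof.
move=> [NGL N0 NM NV] gM gM' qV; rewrite /ncls !nrm_id //.
have [vM vM'] := (GL_valid gM, GL_valid gM'); have vV : mvalid V by case: qV.
have [_ [V' qV']] := gM'; have vV' : mvalid V' by case: qV'.
have E (K W P : mat A) : mvalid K -> qinv K W ->
    (exists M0, qinv K M0 /\ N (circ M0 P)) <-> N (circ W P).
  move=> vK qW; split=> [[M0 [q h]]|h]; last by exists W.
  by rewrite (qinv_uniq hA vK qW q).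
split=> [/seteqP [_ /(_ M')]|h].
  case=> [|_]; last by move/(E _ _ _ vM qV).
  split=> //; exists V'; split=> //.
  by case: qV' => _ [_ ->].
have c := mvalid_circ hA.
have VM : circ V M = mzero A by case: qV => _ [].
have MV : circ M V = mzero A by case: qV => _ [].
have VM' : circ V' M' = mzero A by case: qV' => _ [].
have MV' : circ M' V' = mzero A by case: qV' => _ [].
(* The inverse of [M^-1 M'] is [M'^-1 M]; multiplying by one or the other moves between the two
   cosets. *)
have qVM : qinv (circ V M') (circ V' M).
  apply: (qinv_circ hA) => //; split=> //.
have h' := NV _ _ h qVM.
apply/seteqP; split=> P /= [gP hP]; split=> //; have vP := GL_valid gP.
  apply/(E _ _ _ vM' qV'); move/(E _ _ _ vM qV): hP => hP.
  have -> : circ V' P = circ (circ V' M) (circ V P).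
    by rewrite -(circA hA) // ?(circA hA vM vV) // ?MV ?(circ0m hA) //; apply: c.
  exact: NM.
apply/(E _ _ _ vM qV); move/(E _ _ _ vM' qV'): hP => hP.
have -> : circ V P = circ (circ V M') (circ V' P).
  by rewrite -(circA hA) // ?(circA hA vM' vV') // ?MV' ?(circ0m hA) //; apply: c.
exact: NM.
Qed.

Lemma qcls_eq (N : set (mat A)) (M M' V : mat A) : is_subGL N ->
  GL M -> GL M' -> qinv M V -> qcls N M = qcls N M' <-> N (circ V M').
Proof.
move=> sN gM gM' qV; rewrite -(ncls_eq sN gM gM' qV); split=> [|e].
  by move=> /(congr1 (@proj1_sig _ _)).
exact: quot_eq.
Qed.

(** The representative used by [natmap] differs from [M] by an element of [N1], hence of [N2]. *)
Lemma natmap_qcls (N1 N2 : set (mat A)) (M : mat A) :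
  is_subGL N1 -> is_subGL N2 -> N1 `<=` N2 -> GL M ->
  natmap N2 (qcls N1 M) = qcls N2 M.
Proof.
move=> s1 s2 s12 gM; rewrite /natmap.
have gr := rep_GL (qcls N1 M); have [_ [V qV]] := gr.
apply/(qcls_eq s2 gr gM qV); apply: s12.
by apply/(qcls_eq s1 gr gM qV); rewrite repK.
Qed.

(** An element of [N2] has the class of 1 modulo [N2], so injectivity puts it in [N1]. Conversely,
    for equal subgroups [natmap] sends a class to that of its own representative: it is the
    identity. *)
Lemma natmap_bij (N1 N2 : set (mat A)) :
  is_subGL N1 -> is_subGL N2 -> N1 `<=` N2 ->
  bijective (@natmap R A N1 N2) <-> N2 `<=` N1.
Proof.
move=> s1 s2 s12; have g0 := GL0 hA; have q0 := qinv0 hA.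
have [GL2 _ _ _] := s2; split=> [/bij_inj inj M hM|s21].
  have gM := GL2 _ hM; have vM := GL_valid gM; rewrite -(circ0m hA vM).
  apply/(qcls_eq s1 g0 gM q0); apply: inj; rewrite !natmap_qcls //.
  by apply/(qcls_eq s2 g0 gM q0); rewrite (circ0m hA).
have e : N1 = N2 by apply/seteqP.
subst N2; exists id => X /=; exact: repK.
Qed.
End Quotients.

(** * The criterion for a functorial family of subgroups inside [Nsm] *)

Lemma homotopy_functor_iff (R : realType) (Bc : talg R -> Prop)
    (N : forall A : talg R, set (mat A)) :
  (forall A, Bc A -> is_talg A) -> (forall A, Bc A -> Bc (Ainf A)) ->
  (forall A, is_alg A -> is_subGL (@N A)) ->
  (forall (A B : talg R) (f : tcar A -> tcar B) (M : mat A),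
     is_alg A -> is_alg B -> is_ahom f -> N A M -> N B (mmap f M)) ->
  (forall A, is_talg A -> is_alg (Ainf A) -> @N A `<=` @Nsm R A) ->
  (forall A, Bc A -> bijective (@natmap R A (@N A) (@Nsm R A))) <->
  smooth_homotopy_functor Bc N.
Proof.
move=> HBtalg HBinf NsubGL Nmmap NNsm.
have bij A : Bc A ->
    bijective (@natmap R A (@N A) (@Nsm R A)) <-> @Nsm R A `<=` @N A.
  move=> bA; have tA := HBtalg _ bA; have hA := talg_alg tA.
  have hI := talg_alg (HBtalg _ (HBinf _ bA)).
  by apply: natmap_bij; [|exact: NsubGL|exact: Nsm_subGL|exact: NNsm].
split=> [H A B f g bA bB hf hg [h [hh hfg]]|H A bA].
  have [tA tB] := (HBtalg _ bA, HBtalg _ bB); have [hA hB] := (talg_alg tA, talg_alg tB).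
  have hI := talg_alg (HBtalg _ (HBinf _ bB)).
  have {}hf := hom_ahom hf; have {}hg := hom_ahom hg; have {}hh := hom_ahom hh.
  apply/funext => X; rewrite /qmap; set M := rep X.
  have gM : GL M := rep_GL hA X; have [_ dM] := GL_valid gM.
  have gf := mmap_GL hA hB hf gM; have gg := mmap_GL hA hB hg gM.
  have [_ [V qV]] := gf; have gV := qinv_GL gf qV.
  apply/(qcls_eq hB (NsubGL _ hB) gf gg qV).
  apply: (iffLR (bij _ bB) (H _ bB)).
  have hc := const_path_ahom tB hI; have gh := mmap_GL hA hI hh gM.
  have gcV := mmap_GL hB hI hc gV; have [_ dV] := GL_valid gV.
  apply/(NsmP tB hI); exists (circ (mmap (const_path tB) V) (mmap h M)).
  have [vcV vh] := (GL_valid gcV, GL_valid gh).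
  split; first exact: (GL_circ hI).
    rewrite (mmap_circ hI hB (ev_ahom tB 0)) //.
    have -> : mmap (@ev0 R B) (mmap (const_path tB) V) = V.
      by apply/funext => i; apply/funext => j; apply: ev0_const_path.
    have -> : mmap (@ev0 R B) (mmap h M) = mmap f M.
      by apply/funext => i; apply/funext => j; case: (hfg _ (dM i j)).
    by case: qV => _ [].
  rewrite (mmap_circ hI hB (ev_ahom tB 1)) //.
  have -> : mmap (@ev1 R B) (mmap (const_path tB) V) = V.
    by apply/funext => i; apply/funext => j; apply: ev1_const_path.
  by congr circ; apply/funext => i; apply/funext => j; case: (hfg _ (dM i j)).
apply/(bij _ bA) => M.
have tA := HBtalg _ bA; have hA := talg_alg tA.
have bI := HBinf _ bA; have tI := HBtalg _ bI; have hI := talg_alg tI.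
move=> /(NsmP tA hI) [F [gF F0 ->]].
have [e0 e1] := (ev_ahom tA 0, ev_ahom tA 1).
(* The identity of Ainf A is itself a smooth homotopy from ev0 to ev1. *)
have hom01 : smoothly_homotopic (@ev0 R A) (@ev1 R A).
  exists id; split=> //; split=> //; split=> //; split=> //.
  by apply: continuous_subspaceT => x; apply: cvg_id.
have := H _ _ _ _ bI bA (ev_hom tA 0) (ev_hom tA 1) hom01.
pose X : quot (@N (Ainf A)) := qcls (@N (Ainf A)) F.
move=> /(congr1 (fun k => k X)); rewrite /qmap.
(* [F'] is the matrix chosen for the class of [F], tied to [F] only by [F^-1 F'] lying in [N]. *)
set F' := rep X.
have gF' : GL F' := rep_GL hI X; have [vF [V qV]] := gF.
have sNI := NsubGL _ hI; have sN := NsubGL _ hA; have [NGL N0 NM NV] := sN.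
have NE : N _ (circ V F') by apply/(qcls_eq hI sNI gF gF' qV); rewrite repK.
have g0 := mmap_GL hI hA e0 gF'; have g1 := mmap_GL hI hA e1 gF'.
have [_ [W qW]] := g0.
move/(qcls_eq hA sN g0 g1 qW).
have vF' := GL_valid gF'; have vV : mvalid V by case: qV.
have mv t := mmap_valid hI hA (ev_ahom tA t).
(* At 0 the factor [V = F^-1] is 1, so [F'(0)] itself lies in [N]. *)
have N1 : N _ (mmap (@ev0 R A) F').
  have := Nmmap _ _ _ _ hI hA e0 NE; rewrite (mmap_circ hI hA e0) //.
  have -> : mmap (fun G : tcar (Ainf A) => G 0%N 0) V = mzero A.
    have := mmap_qinv hI hA e0 vF qV; rewrite [mmap _ F]F0 => h.
    exact: (qinv_uniq hA (mvalid0 hA) h (qinv0 hA)).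
  by rewrite (circ0m hA) //; apply: mv.
(* Multiplying [F'(0)] by [F'(0)^-1 F'(1)], which lies in [N] by homotopy invariance, puts [F'(1)]
   in [N]. *)
move=> /(NM _ _ N1); have qc : circ (mmap (@ev0 R A) F') W = mzero A by case: qW => _ [].
have vW : mvalid W by case: qW.
rewrite (circA hA) //; try exact: mv.
rewrite qc (circ0m hA); last exact: mv.
move=> N1'; have := Nmmap _ _ _ _ hI hA e1 NE; rewrite (mmap_circ hI hA e1) //.
set a := mmap _ F' in N1' *; set b := mmap _ V => Nba.
have [_ [K qK]] := g1; have NK := NV _ _ N1' qK.
have [va vb vK] : [/\ mvalid a, mvalid b & mvalid K].
  by split; [exact: mv|exact: mv|case: qK].
(* Both [b a = F(1)^-1 F'(1)] and [a = F'(1)] lie in [N], hence so does [b], and its inverse is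
   [F(1)]. *)
have Nb : N _ b.
  have -> : b = circ (circ b a) K; last exact: NM.
  by case: qK => _ [aK _]; rewrite -(circA hA) // aK (circm0 hA).
by apply: (NV _ _ Nb); apply: (qinv_sym (mv _ _ vF)); apply: (mmap_qinv hI hA e1).
Qed.

Theorem theorem3p3 (R : realType) (Bc : talg R -> Prop)
    (HBtalg : forall A, Bc A -> is_talg A)
    (HBinf : forall A, Bc A -> Bc (Ainf A)) :
  ((forall A, Bc A -> bijective (@K1_to_K1sm R A)) <->
     smooth_homotopy_functor Bc (@Erel R)) /\
  ((forall A, Bc A -> bijective (@kv1_to_K1sm R A)) <->
     smooth_homotopy_functor Bc (@Nkv R)).
Proof.
split; apply: homotopy_functor_iff => // [A hA|A B f M|A tA hI M].
- exact: Erel_subGL.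
- exact: Erel_mmap.
- exact: Erel_Nsm.
- exact: Nkv_subGL.
- exact: Nkv_mmap.
- exact: Nkv_Nsm.
Qed.
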